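(* Let $N\ge1$, let $q\ge q_*:=\frac{N+2}{N+1}$, let $T\in(0,\infty]$ and $Q_{\mathbb{R}^N,T}=\mathbb{R}^N\times(0,T)$. Let $u\in L^1_{loc}(Q_{\mathbb{R}^N,T})$, $u\ge0$, be such that $|\nabla u|\in L^q_{loc}(Q_{\mathbb{R}^N,T})$ and $$u_t-\Delta u+|\nabla u|^q=0\quad\text{in }\mathcal{D}'(Q_{\mathbb{R}^N,T}),\qquad \lim_{t\to0}\int_{\mathbb{R}^N} u(\cdot,t)\varphi\,dx=0\quad\forall\varphi\in C_c(\mathbb{R}^N\setminus\{0\}).$$ Then $u(x,t)=0$ for a.e. $x\in\mathbb{R}^N$, for every $t\in(0,T)$.
   Context: Any nonnegative $u$ as in the statement belongs to $C((0,T);L^1_{loc}(\mathbb{R}^N))$ (after modification on a null set), and $u(\cdot,t)$ refers to this representative. No condition is imposed as $|x|\to\infty$. *)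

(* Defs.v *)
From HB Require Import structures.
From mathcomp Require Import all_boot all_order all_algebra.
From mathcomp Require Import all_classical all_reals all_analysis.

Set Implicit Arguments.
Unset Strict Implicit.
Unset Printing Implicit Defensive.

Import Order.TTheory GRing.Theory Num.Theory.
Import numFieldNormedType.Exports.

Local Open Scope classical_set_scope.
Local Open Scope ring_scope.

(* 'rV[R]_n carries the sigma-algebra generated by the coordinates, which is
   the Borel sigma-algebra of R^n (this mirrors the library's n.-tuple). *)
Definition measure_rV_display : measure_display -> measure_display.
Proof. exact. Qed.

Section measurable_rV.
Context {d} {T : sigmaRingType d} (n : nat).

Let coord : 'I_n -> 'rV[T]_n -> T := fun i x => x ord0 i.

Let rV_set0 : g_sigma_preimage coord set0.
Proof. exact: sigma_algebra0. Qed.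

Let rV_setC A : g_sigma_preimage coord A -> g_sigma_preimage coord (~` A).
Proof. exact: sigma_algebraC. Qed.

Let rV_bigcup (F : _^nat) : (forall i, g_sigma_preimage coord (F i)) ->
  g_sigma_preimage coord (\bigcup_i (F i)).
Proof. exact: sigma_algebra_bigcup. Qed.

HB.instance Definition _ := @isMeasurable.Build (measure_rV_display d)
  'rV[T]_n (g_sigma_preimage coord) rV_set0 rV_setC rV_bigcup.

End measurable_rV.

Section lebesgue_rV.
Variable R : realType.

Definition rV_cons n (p : R * 'rV[R]_n) : 'rV[R]_n.+1 :=
  \row_i (if unlift ord0 i is Some j then p.2 ord0 j else p.1).

Lemma measurable_rV_coord n (i : 'I_n) :
  measurable_fun [set: 'rV[R]_n] (fun x => x ord0 i).
Proof.
move=> _ Y mY; rewrite setTI; apply: sub_sigma_algebra => /=.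
rewrite -bigcup_seq/=; exists i => /=; first by rewrite mem_index_enum.
by exists Y => //; rewrite setTI.
Qed.

Lemma measurable_to_rV d (X : measurableType d) n (f : X -> 'rV[R]_n) :
  (forall i, measurable_fun setT (fun x => f x ord0 i)) ->
  measurable_fun setT f.
Proof.
move=> mf _ Y mY; rewrite setTI.
pose F := image_set_system setT f measurable.
suff : F Y by rewrite /F /image_set_system /= setTI.
apply: mY; split; first exact/sigma_algebra_image/sigma_algebra_measurable.
move=> A; rewrite -bigcup_seq => -[i _ [B mB <-]].
rewrite /F /image_set_system /= !setTI -[_ @^-1` _]setTI.
exact: mf.
Qed.

Lemma measurable_rV_cons n :
  measurable_fun [set: R * 'rV[R]_n] (@rV_cons n).
Proof.
apply: measurable_to_rV => i; rewrite /rV_cons.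
under eq_fun do rewrite mxE.
case: unliftP => [j _|_]; last exact: measurable_fst.
exact: (measurableT_comp (measurable_rV_coord j) measurable_snd).
Qed.

Section lebesgue_rV_step.
Local Open Scope ereal_scope.
Variables (n : nat) (mu : {sigma_finite_measure set 'rV[R]_n -> \bar R}).

Definition lebesgue_rV_step : set 'rV[R]_n.+1 -> \bar R :=
  pushforward (@lebesgue_measure R \x mu) (@rV_cons n).

Let mpre A : measurable A -> measurable (@rV_cons n @^-1` A).
Proof. by move=> mA; rewrite -[X in measurable X]setTI; exact: measurable_rV_cons. Qed.

Let step0 : lebesgue_rV_step set0 = 0.
Proof. by rewrite /lebesgue_rV_step /pushforward preimage_set0 measure0. Qed.

Let step_ge0 A : 0 <= lebesgue_rV_step A.
Proof. by rewrite /lebesgue_rV_step /pushforward; exact: (measure_ge0 (lebesgue_measure \x mu)). Qed.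

Let step_sigma_additive : semi_sigma_additive lebesgue_rV_step.
Proof.
move=> F mF tF mUF; rewrite /lebesgue_rV_step /pushforward preimage_bigcup.
apply: measure_semi_sigma_additive.
- by move=> k; exact: mpre.
- apply/trivIsetP => /= i j _ _ ij; rewrite -preimage_setI.
  by move/trivIsetP : tF => /(_ _ _ _ _ ij) ->//; rewrite preimage_set0.
- by rewrite -preimage_bigcup; exact: mpre.
Qed.

HB.instance Definition _ := isMeasure.Build _ _ _ lebesgue_rV_step
  step0 step_ge0 step_sigma_additive.

Lemma lebesgue_rV_stepE (A : set R) (B : set 'rV[R]_n) :
  measurable A -> measurable B ->
  lebesgue_rV_step [set x | A (x ord0 ord0) /\
                           B (\row_i x ord0 (lift ord0 i))] =
  lebesgue_measure A * mu B.
Proof.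
move=> mA mB; rewrite -product_measure1E//.
congr (_ \x _) => //; apply/seteqP.
suff E (p : R * 'rV[R]_n) : (rV_cons p ord0 ord0 = p.1) *
    (\row_i rV_cons p ord0 (lift ord0 i) = p.2).
  by split=> p /=; rewrite !E.
split; first by rewrite mxE unlift_none.
by apply/rowP => i; rewrite !mxE liftK.
Qed.

Let step_sigma_finite : sigma_finite setT lebesgue_rV_step.
Proof.
have /sigma_finiteP[F [FT ndF Foo]] := sigma_finiteT (@lebesgue_measure R).
have /sigma_finiteP[G [GT ndG Goo]] := sigma_finiteT mu.
exists (fun k => [set x : 'rV[R]_n.+1 | F k (x ord0 ord0) /\
                          G k (\row_i x ord0 (lift ord0 i))]).
  apply/seteqP; split=> // x _.
  have [a _ Fa] : (\bigcup_k F k) (x ord0 ord0) by rewrite -FT.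
  have [b _ Gb] : (\bigcup_k G k) (\row_i x ord0 (lift ord0 i)) by rewrite -GT.
  exists (maxn a b) => //; split.
    by move: Fa; exact/subsetPset/ndF/leq_maxl.
  by move: Gb; exact/subsetPset/ndG/leq_maxr.
move=> k; have [mF Fk] := Foo k; have [mG Gk] := Goo k; split.
  apply: measurableI.
    by rewrite -[X in measurable X]setTI; exact: measurable_rV_coord.
  rewrite -[X in measurable X]setTI.
  suff /(_ measurableT _ mG) : measurable_fun setT (fun x : 'rV[R]_n.+1 =>
    \row_i x ord0 (lift ord0 i)) by [].
  apply: measurable_to_rV => i.
  under eq_fun do rewrite mxE.
  exact: measurable_rV_coord.
by rewrite lebesgue_rV_stepE// lte_mul_pinfty// ge0_fin_numE.
Qed.

HB.instance Definition _ :=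
  Measure_isSigmaFinite.Build _ _ _ lebesgue_rV_step step_sigma_finite.

End lebesgue_rV_step.


(* Lebesgue measure on R^n as the n-fold product of the Lebesgue measure on R;
   R^0 is a point of mass 1. *)
Fixpoint lebesgue_rV n : {sigma_finite_measure set 'rV[R]_n -> \bar R} :=
  if n is m.+1 then lebesgue_rV_step (lebesgue_rV m) else dirac (0 : 'rV[R]_0).

Lemma lebesgue_rV_box n (A : 'I_n -> set R) : (forall i, measurable (A i)) ->
  lebesgue_rV n [set x | forall i, A i (x ord0 i)] =
  (\prod_(i < n) lebesgue_measure (A i))%E.
Proof.
elim: n => [|n IH] in A *; move=> mA.
  by rewrite big_ord0 /= diracE mem_set// => -[].
rewrite big_ord_recl -IH//= -lebesgue_rV_stepE//.
  congr (lebesgue_rV_step _ _); apply/seteqP; split=> x /=.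
    by move=> Ax; split=> // i; rewrite mxE.
  move=> [A0 AS] i; case: (unliftP ord0 i) => [j|] -> //.
  by have := AS j; rewrite mxE.
rewrite [X in measurable X](_ : _ = \bigcap_(i in [set: 'I_n])
    ((fun x : 'rV[R]_n => x ord0 i) @^-1` A (lift ord0 i))); last first.
  by apply/seteqP; split=> x /= Ax i => [_|]; exact: Ax.
apply: fin_bigcap_measurable => // i _.
by rewrite -[X in measurable X]setTI; exact: measurable_rV_coord.
Qed.

End lebesgue_rV.

Section function_spaces.
Variable R : realType.

Definition compact_subset (X : topologicalType) (D : set X) : set (set X) :=
  [set K | compact K /\ K `<=` D].

(* L^p_loc(D), to be used with Ks the family of compact subsets of D; Ks is a
   parameter because no library structure joins topology and measurability. *)
Definition locally_Lp d (X : measurableType d) (mu : {measure set X -> \bar R})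
    (p : R) (D : set X) (Ks : set (set X)) (f : X -> R) : Prop :=
  measurable_fun D f /\
  forall K, Ks K -> (\int[mu]_(x in K) (`|f x| `^ p)%:E < +oo)%E.

Definition fun_support (X : topologicalType) (f : X -> R) : set X :=
  closure [set x | f x != 0].

Definition Cc (X : topologicalType) (D : set X) (f : X -> R) : Prop :=
  [/\ continuous f, compact (fun_support f) & fun_support f `<=` D].

Fixpoint iter_derive (V : normedModType R) (s : seq V) (f : V -> R) : V -> R :=
  if s is v :: s' then 'D_v (iter_derive s' f) else f.

(* On a finite-dimensional V this is C^oo. *)
Definition smooth (V : normedModType R) (f : V -> R) : Prop :=
  forall s : seq V, continuous (iter_derive s f) /\
    forall x v, derivable (iter_derive s f) x v.

Definition test_function (V : normedModType R) (D : set V) (f : V -> R) :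
  Prop := smooth f /\ Cc D f.

End function_spaces.

Section viscous_Hamilton_Jacobi.
Variables (R : realType) (N : nat).

(* Needed because the library's norm on 'rV[R]_N is the sup norm. *)
Definition euclidean_norm (x : 'rV[R]_N) : R :=
  Num.sqrt (\sum_(i < N) x ord0 i ^+ 2).

Definition lebesgue_spacetime :
    {measure set ('rV[R]_N * measurableTypeR R) -> \bar R} :=
  (lebesgue_rV R N \x @lebesgue_measure R)%E.

Definition cylinder (T : \bar R) : set ('rV[R]_N * R) :=
  [set z | 0 < z.2 /\ (z.2%:E < T)%E].

Definition Lp_loc_cylinder (T : \bar R) (p : R) (f : 'rV[R]_N * R -> R) :=
  locally_Lp lebesgue_spacetime p (cylinder T) (compact_subset (cylinder T)) f.

Definition L1_loc_space (f : 'rV[R]_N -> R) :=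
  locally_Lp (lebesgue_rV R N) 1 setT (compact_subset setT) f.

Definition partial_x (i : 'I_N) (f : 'rV[R]_N * R -> R) : 'rV[R]_N * R -> R :=
  'D_(delta_mx ord0 i, 0) f.

Definition partial_t (f : 'rV[R]_N * R -> R) : 'rV[R]_N * R -> R :=
  'D_(0, 1) f.

Definition laplacian (f : 'rV[R]_N * R -> R) : 'rV[R]_N * R -> R :=
  fun z => \sum_(i < N) partial_x i (partial_x i f) z.

Definition pairing (T : \bar R) (f phi : 'rV[R]_N * R -> R) : R :=
  \int[lebesgue_spacetime]_(z in cylinder T) (f z * phi z).

Definition is_weak_gradient (T : \bar R) (u : 'rV[R]_N * R -> R)
    (Du : 'rV[R]_N * R -> 'rV[R]_N) : Prop :=
  forall i : 'I_N, Lp_loc_cylinder T 1 (fun z => Du z ord0 i) /\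
    forall phi, test_function (cylinder T) phi ->
      pairing T u (partial_x i phi) = - pairing T (fun z => Du z ord0 i) phi.

(* u_t - Laplacian u + |Du|^q = 0 in D'(Q_T) *)
Definition viscous_HJ (T : \bar R) (q : R) (u : 'rV[R]_N * R -> R)
    (Du : 'rV[R]_N * R -> 'rV[R]_N) : Prop :=
  forall phi, test_function (cylinder T) phi ->
    - pairing T u (partial_t phi) - pairing T u (laplacian phi)
    + pairing T (fun z => euclidean_norm (Du z) `^ q) phi = 0.

(* v t x stands for u(x,t), with t |-> v t in C((0,T); L^1_loc(R^N)); such a v
   is unique up to a null set of x for every t in (0,T). *)
Definition continuous_representative (T : \bar R) (u : 'rV[R]_N * R -> R)
    (v : R -> 'rV[R]_N -> R) : Prop :=
  [/\ {ae lebesgue_spacetime, forall z, cylinder T z -> v z.2 z.1 = u z},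
      forall t : R, 0 < t -> (t%:E < T)%E -> L1_loc_space (v t) &
      forall s : R, 0 < s -> (s%:E < T)%E ->
      forall K : set 'rV[R]_N, compact K ->
        (\int[lebesgue_rV R N]_(x in K) `|v t x - v s x|) @[t --> s] --> 0].

End viscous_Hamilton_Jacobi.

(* Main.v *)
Require Import Defs.
From mathcomp Require Import all_boot all_order all_algebra.
From mathcomp Require Import all_classical all_reals all_analysis.
From mathcomp Require Import measurable_realfun ring lra.

(* Write p = (N+2)/(N+1) <= q, whose conjugate exponent is N+2. Testing the equation
   with xi^(N+2) and absorbing the gradient by Young's inequality bounds the mass of
   u(t) where xi = 1 by C t (int (|grad xi| + |grad xi|^(N+2))). A cutoff xi
   vanishing for |x| < e shows that the mass outside {|x| < e} is at most K t / e^2.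
   The mass inside is controlled by e |grad u|, since N = div x; with e of order
   sqrt t the exponent p is exactly the one for which the total mass y satisfies
   - y' >= c y^p / t as long as y stays above a positive threshold. Such a y
   blows up at a positive time when followed backwards, so the mass tends to 0 as t -> 0,
   near the origin included. Hence the mass of u(t) in a box of size r is O(r^N), and
   the comparison m_r(t) <= C r^-2 int_0^t m_(2r) for the heat equation, iterated,
   improves this to O(r^(N-2k)) for every k, so that u = 0.
   The only test functions are products of a function of x and a smooth step in t. *)

Set Implicit Arguments.
Unset Strict Implicit.
Unset Printing Implicit Defensive.

Import Order.TTheory GRing.Theory Num.Theory.
Import numFieldNormedType.Exports.

Local Open Scope classical_set_scope.
Local Open Scope ring_scope.

(** * Smooth functions built from exp(-1/x) *)

(** The condition at t -> 0 leaves open a point mass at the origin; excluding it is the obstacle,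
    and scaling decides. Young's inequality with weight m on a box of size e leaves a remainder of
    order e^(N+2) e^N / m^(N+1); for e^2 = L t and m = K t this is a multiple of (L/K)^(N+1), free
    of t. The weight K stays free and is chosen anew along the backward iteration, which amounts to
    optimizing it into the power p. The threshold comes from the mass outside the small box, of
    order t / e^2 = 1 / L: large L makes it as small as desired, not zero. When q exceeds p, the
    region |grad u| <= 1 costs one more term, linear in e. The power N+2 of the cutoff is the one
    whose gradient carries xi^(N+1) = (xi^(N+2))^(1/p), so that Young's inequality meets no singular
    weight. As nothing is assumed at infinity, every estimate keeps an explicit radius, and decay in
    that radius stands in for a global argument. *)

Section flat_functions.
Variable R : realType.
Implicit Types (p : {poly R}) (x y : R).

Definition flat p x : R := if 0 < x then p.[x^-1] * expR (- x^-1) else 0.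

(** With y = 1/x, the derivative in x of p(y) e^(-y) is y^2 (p - p')(y) e^(-y): the family [flat p]
    is closed under differentiation. *)
Definition dflat p : {poly R} := 'X^2 * (p - p^`()).

(** Coefficient by coefficient, from y^k <= k! e^y. *)
Lemma horner_le_expR p : exists2 K : R, 0 <= K &
  forall y, 0 <= y -> `|p.[y]| <= K * expR y.
Proof.
exists (\sum_(i < size p) `|p`_i| * i`!%:R).
  by apply: sumr_ge0 => i _; rewrite mulr_ge0.
move=> y y0; rewrite horner_coef mulr_suml.
apply: (le_trans (ler_norm_sum _ _ _)); apply: ler_sum => i _.
rewrite normrM -mulrA ler_wpM2l// ger0_norm ?exprn_ge0//.
case: (nat_of_ord i) => [|k].
  rewrite expr0 fact0 mul1r; apply: le_trans (expR_ge1Dx y); lra.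
have f0 : 0 < (k.+1)`!%:R :> R by rewrite ltr0n fact_gt0.
rewrite -ler_pdivrMl// mulrC.
apply: le_trans (expR_ge1Dxn k y0); lra.
Qed.

(** The previous bound for p X^2 at y = 1/x. It makes the difference quotient of [flat p] at 0 of
    order h, which settles differentiability at 0 for all [p] at once. *)
Lemma flat_sqr_bound p : exists2 K : R, 0 <= K &
  forall x, `|flat p x| <= K * x ^+ 2.
Proof.
have [K K0 pK] := horner_le_expR (p * 'X^2); exists K => // x.
rewrite /flat; case: ifPn => [x0|_]; last by rewrite normr0 mulr_ge0 ?sqr_ge0.
have xi : 0 < x^-1 by rewrite invr_gt0.
have := pK _ (ltW xi); rewrite hornerM hornerXn normrM.
rewrite (ger0_norm (exprn_ge0 _ (ltW xi))) => H.
rewrite normrM (ger0_norm (expR_ge0 _)) expRN ler_pdivrMr ?expR_gt0//.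
have -> : `|p.[x^-1]| = `|p.[x^-1]| * x^-1 ^+ 2 * x ^+ 2.
  by rewrite -mulrA -exprMn mulVf ?expr1n ?mulr1// gt_eqF.
by rewrite [leRHS]mulrAC ler_wpM2r// sqr_ge0.
Qed.

Lemma is_derive_flat p x : is_derive x 1 (flat p) (flat (dflat p) x).
Proof.
have [x0|x0|->] := ltgtP x 0.
- rewrite {2}/flat ltNge (ltW x0) /=.
  apply: (@near_eq_is_derive _ _ _ (cst 0)).
  near=> y; rewrite /flat ifF//; apply/negbTE; rewrite -leNgt.
  by apply/ltW; near: y; exact: lt_nbhsl.
- rewrite {2}/flat x0.
  apply: (@near_eq_is_derive _ _ _ (fun y => p.[y^-1] * expR (- y^-1))).
    near=> y; rewrite /flat ifT//; near: y; exact: lt_nbhsr.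
  have xn0 : x != 0 by rewrite gt_eqF.
  have dV : is_derive x 1 (fun y : R => y^-1) (- x ^- 2).
    have := is_deriveV xn0 (is_derive_id x (1 : R)).
    by rewrite /GRing.scale /= mulr1.
  have dp : is_derive x 1 (fun y : R => p.[y^-1]) (- x ^- 2 * p^`().[x^-1]).
    by rewrite mulrC; exact: (is_derive1_comp (is_derive_poly p x^-1) dV).
  have de : is_derive x 1 (fun y : R => expR (- y^-1)) (x ^- 2 * expR (- x^-1)).
    have dN : is_derive x 1 (fun y : R => - y^-1) (x ^- 2).
      by apply: (is_derive_eq (is_deriveN dV)); rewrite opprK.
    by rewrite mulrC; exact: (is_derive1_comp (is_derive_expR _) dN).
  apply: (is_derive_eq (is_deriveM dp de)).
  rewrite /dflat hornerM hornerXn hornerD hornerN /GRing.scale /= exprVn.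
  ring.
- have [K K0 pK] := flat_sqr_bound p.
  rewrite {2}/flat ltxx.
  have f0 : flat p 0 = 0 by rewrite /flat ltxx.
  suff H : h^-1 *: ((flat p \o shift 0) (h *: 1) - flat p 0) @[h --> 0^'] --> (0:R).
    apply: DeriveDef; first by apply/cvg_ex; exists 0.
    exact/cvg_lim.
  apply/cvgr0Pnorm_le => e e0; near=> h.
  rewrite f0 subr0 /= addr0 /GRing.scale /= mulr1.
  have h0 : h != 0 by near: h; exact: nbhs_dnbhs_neq.
  rewrite normrM normfV ler_pdivrMl ?normr_gt0//.
  apply: le_trans (pK h) _.
  rewrite -[h ^+ 2]ger0_norm ?sqr_ge0// normrX expr2 mulrCA ler_wpM2l//.
  rewrite -[leRHS]mul1r; apply: le_trans (_ : (K + 1) * `|h| <= _).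
    by rewrite ler_wpM2r// lerDl.
  rewrite mul1r mulrC -ler_pdivlMr ?ltr_wpDl//.
  by near: h; apply: dnbhs0_le; rewrite divr_gt0// ltr_wpDl.
Unshelve. all: by end_near.
Qed.

Lemma continuous_flat p : continuous (flat p).
Proof.
move=> x; apply: differentiable_continuous; apply/derivable1_diffP.
exact: (@ex_derive _ _ _ _ _ _ _ (is_derive_flat p x)).
Qed.

Lemma differentiable_flat p x : differentiable (flat p) x.
Proof.
by apply/derivable1_diffP; exact: (@ex_derive _ _ _ _ _ _ _ (is_derive_flat p x)).
Qed.

Lemma diff_flat p x h : 'd (flat p) x h = flat (dflat p) x * h.
Proof.
have := deriv1E (@ex_derive _ _ _ _ _ _ _ (is_derive_flat p x)) => ->.
by rewrite derive1E (@derive_val _ _ _ _ _ _ _ (is_derive_flat p x)) /GRing.scale /= mulrC.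
Qed.

Lemma flat1_le0 x : x <= 0 -> flat 1 x = 0.
Proof. by move=> x0; rewrite /flat ltNge x0. Qed.

Lemma flat1_gt0 x : 0 < x -> 0 < flat 1 x.
Proof. by move=> x0; rewrite /flat x0 hornerC mul1r expR_gt0. Qed.

Lemma flat1_ge0 x : 0 <= flat 1 x.
Proof.
by have [/flat1_le0->//|/flat1_gt0/ltW] := leP x 0.
Qed.

Lemma flat1_homo : {homo flat 1 : x y / x <= y}.
Proof.
move=> x y xy; have [x0|x0] := leP x 0; first by rewrite flat1_le0// flat1_ge0.
have y0 := lt_le_trans x0 xy.
by rewrite /flat x0 y0 !hornerC !mul1r ler_expR lerN2 lef_pV2.
Qed.

End flat_functions.

(** * A class of functions closed under differentiation *)

Section elementary_functions.
Variable R : realType.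

(** Since directional derivatives stay in this class, smoothness is an induction on the list of
    directions, and every derivative needed later can be computed by rules. *)
Inductive elem (V : normedModType R) : (V -> R) -> Prop :=
| elem_cst c : elem (fun=> c)
| elem_lin (l : {linear V -> R}) : continuous l -> elem l
| elemD f g : elem f -> elem g -> elem (fun x => f x + g x)
| elemM f g : elem f -> elem g -> elem (fun x => f x * g x)
| elem_flat p f : elem f -> elem (fun x => flat p (f x)).

Section closure.
Variable V : normedModType R.
Implicit Types f g : V -> R.

Lemma elem_differentiable f x : elem f -> differentiable f x.
Proof.
elim=> {f} [c|l cl|f g _ df _ dg|f g _ df _ dg|p f _ df].
- exact: differentiable_cst.
- exact/linear_differentiable/cl.
- exact: differentiableD.
- exact: differentiableM.
- exact: (differentiable_comp df (differentiable_flat _ _)).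
Qed.

Lemma elem_continuous f : elem f -> continuous f.
Proof. by move=> ef x; apply/differentiable_continuous/elem_differentiable. Qed.

Lemma elem_derivable f x v : elem f -> derivable f x v.
Proof. by move=> ef; apply/diff_derivable/elem_differentiable. Qed.

Lemma elem_deriveM f g v x : elem f -> elem g ->
  'D_v (fun x => f x * g x) x = f x * 'D_v g x + g x * 'D_v f x.
Proof. by move=> ef eg; rewrite (deriveM (elem_derivable (x := x) (v := v) ef) (elem_derivable (x := x) (v := v) eg)). Qed.

Lemma elem_deriveD f g v x : elem f -> elem g ->
  'D_v (fun x => f x + g x) x = 'D_v f x + 'D_v g x.
Proof. by move=> ef eg; rewrite (deriveD (elem_derivable (x := x) (v := v) ef) (elem_derivable (x := x) (v := v) eg)). Qed.

Lemma elem_derive_lin (l : {linear V -> R}) v x : continuous l -> 'D_v l x = l v.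
Proof.
by move=> cl; rewrite deriveE ?diff_lin//; exact/linear_differentiable/cl.
Qed.

Lemma elem_derive_flat p f v x : elem f ->
  'D_v (fun x => flat p (f x)) x = flat (dflat p) (f x) * 'D_v f x.
Proof.
move=> ef; have df := elem_differentiable x ef.
rewrite !deriveE//; last exact: (differentiable_comp df (differentiable_flat _ _)).
by rewrite (diff_comp df (differentiable_flat _ _)) /= diff_flat.
Qed.

Lemma elem_derive f v : elem f -> elem ('D_v f).
Proof.
elim=> {f} [c|l cl|f g ef df eg dg|f g ef df eg dg|p f ef df].
- rewrite (_ : 'D_v _ = fun=> 0); first exact: elem_cst.
  by apply/funext => x; rewrite derive_cst.
- rewrite (_ : 'D_v _ = fun=> l v); first exact: elem_cst.
  by apply/funext => x; rewrite elem_derive_lin.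
- rewrite (_ : 'D_v _ = fun x => 'D_v f x + 'D_v g x); first exact: elemD.
  by apply/funext => x; rewrite elem_deriveD.
- rewrite (_ : 'D_v _ = fun x => f x * 'D_v g x + g x * 'D_v f x).
    by apply: elemD; exact: elemM.
  by apply/funext => x; rewrite elem_deriveM.
- rewrite (_ : 'D_v _ = fun x => flat (dflat p) (f x) * 'D_v f x).
    by apply: elemM => //; exact: elem_flat.
  by apply/funext => x; rewrite elem_derive_flat.
Qed.

Lemma elem_smooth f : elem f -> smooth f.
Proof.
move=> ef s; have es : elem (iter_derive s f).
  by elim: s => //= v s; exact: elem_derive.
by split; [exact: elem_continuous|move=> x v; exact: elem_derivable].
Qed.

Lemma elem_deriveZv f (c : R) v x : elem f -> 'D_(c *: v) f x = c * 'D_v f x.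
Proof.
move=> ef; have df := elem_differentiable x ef.
by rewrite !deriveE// linearZ.
Qed.

Lemma elemZ c f : elem f -> elem (fun x => c * f x).
Proof. by move=> ef; apply: elemM => //; exact: elem_cst. Qed.

Lemma elemN f : elem f -> elem (fun x => - f x).
Proof.
by move=> /(elemZ (-1)); congr elem; apply/funext => x; rewrite mulN1r.
Qed.

Lemma elemB f g : elem f -> elem g -> elem (fun x => f x - g x).
Proof. by move=> ef eg; apply: elemD => //; exact: elemN. Qed.

Lemma elem_sum (I : Type) (s : seq I) (f : I -> V -> R) :
  (forall i, elem (f i)) -> elem (fun x => \sum_(i <- s) f i x).
Proof.
move=> ef; elim: s => [|i s IH].
  by under eq_fun do rewrite big_nil; exact: elem_cst.
by under eq_fun do rewrite big_cons; exact: elemD.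
Qed.

Lemma elem_exp f n : elem f -> elem (fun x => f x ^+ n).
Proof.
move=> ef; elim: n => [|n IH].
  by under eq_fun do rewrite expr0; exact: elem_cst.
by under eq_fun do rewrite exprS; exact: elemM.
Qed.

Lemma elem_deriveX f n v x : elem f ->
  'D_v (fun x => f x ^+ n.+1) x = n.+1%:R * f x ^+ n * 'D_v f x.
Proof.
move=> ef; elim: n => [|n IH].
  by under eq_fun do rewrite expr1; rewrite expr0 !mul1r.
under eq_fun do rewrite exprS; rewrite elem_deriveM//; last exact: elem_exp.
by rewrite IH -[in RHS]natr1 exprS; ring.
Qed.

Lemma elem_deriveZ f c v x : elem f ->
  'D_v (fun x => c * f x) x = c * 'D_v f x.
Proof.
by move=> ef; rewrite elem_deriveM ?derive_cst ?mulr0 ?addr0//; exact: elem_cst.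
Qed.

Lemma derive_vanish f v x : (\forall y \near x, f y = 0) -> 'D_v f x = 0.
Proof.
by move=> f0; rewrite (near_eq_derive (g := cst 0)) ?derive_cst//.
Qed.

End closure.

Lemma elem_comp (V W : normedModType R) (L : {linear V -> W}) (f : W -> R) :
  continuous L -> elem f -> elem (fun x => f (L x)).
Proof.
move=> cL; elim=> {f} [c|l cl|f g _ df _ dg|f g _ df _ dg|p f _ df].
- exact: elem_cst.
- by apply: (elem_lin (l := l \o L)) => x; apply: continuous_comp; [exact: cL|exact: cl].
- exact: elemD.
- exact: elemM.
- exact: elem_flat.
Qed.

(** By linearity the two difference quotients are the same function of [h], so their limits agree,
    whether or not they exist. *)
Lemma derive_comp_lin (V W : normedModType R) (L : {linear V -> W}) (f : W -> R) v x :
  'D_v (fun x => f (L x)) x = 'D_(L v) f (L x).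
Proof.
have E (h : R) : L (h *: v + x) = h *: L v + L x by exact: linearP.
have H : (fun h : R => h^-1 *: (f (L (h *: v + x)) - f (L x))) =
    (fun h : R => h^-1 *: (f (h *: L v + L x) - f (L x))).
  by apply: funext => h; rewrite E.
by rewrite /derive; have := congr1 (fun k => lim (k @ 0^')) H.
Qed.

End elementary_functions.

(** * Spatial test functions *)

Section spatial_tests.
Variables (R : realType) (N : nat).
Local Notation X := 'rV[R]_N.
Implicit Types (x : X) (f : X -> R) (i : 'I_N) (r e : R).

Definition box r : set X := [set x | forall i, `|x ord0 i| <= r].

Definition dir i : X := delta_mx ord0 i.

Lemma box_le r s : r <= s -> box r `<=` box s.
Proof. by move=> rs x xr i; exact: le_trans (xr i) rs. Qed.

Lemma box_compact r : compact (box r).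
Proof.
have -> : box r = [set x | forall i, `[- r, r]%classic (x ord0 i)].
  by apply/seteqP; split=> x /= H i; have := H i; rewrite /= in_itv /= ler_norml.
by apply: (@rV_compact _ _ (fun=> `[- r, r]%classic)) => i; exact: segment_compact.
Qed.

Lemma box_closed r : closed (box r).
Proof. by apply: compact_closed; [exact: norm_hausdorff|exact: box_compact]. Qed.

Lemma near_inside_box r x : (forall i, `|x ord0 i| < r) -> \forall y \near x, box r y.
Proof.
move=> xr; suff H : \forall y \near x, forall i, `|(y : X) ord0 i| <= r by [].
apply: (@filter_forall X 'I_N (fun i y => `|y ord0 i| <= r) (nbhs x) _) => i.
have := @coord_continuous R 1 N ord0 i x [set t | `|t| <= r]; apply => /=.
near=> t; apply/ltW; near: t.
have : {for x ord0 i, continuous (fun t : R => `|t|)} by exact: norm_continuous.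
by move=> /(_ [set t | t < r]) /=; apply; exact: lt_nbhsl.
Unshelve. all: by end_near.
Qed.

Lemma near_outside_box r x : ~ box r x -> \forall y \near x, ~ box r y.
Proof. by move=> xr; apply: open_nbhs_nbhs; split => //; exact/closed_openC/box_closed. Qed.

Lemma elem_coord i : elem (fun x : X => x ord0 i).
Proof.
have @l : {linear X -> R}.
  by exists (fun x : X => x ord0 i); do 2![eexists]; do ?[constructor];
     rewrite ?mxE// => ? *; rewrite ?mxE//; move=> ?; rewrite !mxE.
rewrite (_ : (fun _ => _) = l)//; apply: elem_lin; exact: coord_continuous.
Qed.

Lemma derive_coord i j x : 'D_(dir j) (fun x : X => x ord0 i) x = (i == j)%:R.
Proof.
have @l : {linear X -> R}.
  by exists (fun x : X => x ord0 i); do 2![eexists]; do ?[constructor];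
     rewrite ?mxE// => ? *; rewrite ?mxE//; move=> ?; rewrite !mxE.
rewrite (_ : (fun _ => _) = l)// elem_derive_lin; last exact: coord_continuous.
by rewrite /l /= mxE.
Qed.

(** The support is recorded by an explicit radius. As the complement of a box is open, derivatives
    keep the same radius. *)
Definition stest r f := elem f /\ forall x, ~ box r x -> f x = 0.

Lemma stest_elem r f : stest r f -> elem f. Proof. by case. Qed.

Lemma stest_le r s f : r <= s -> stest r f -> stest s f.
Proof. by move=> rs [ef f0]; split => // x xs; apply: f0 => /(box_le rs). Qed.

Lemma stest_derive r f v : stest r f -> stest r ('D_v f).
Proof.
move=> [ef f0]; split; first exact: elem_derive.
move=> x xr; apply: derive_vanish.
by near=> y; apply: f0; near: y; exact: near_outside_box.
Unshelve. all: by end_near.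
Qed.

Lemma stestMl r f g : elem f -> stest r g -> stest r (fun x => f x * g x).
Proof. by move=> ef [eg g0]; split; [exact: elemM|move=> x /g0->; rewrite mulr0]. Qed.

Lemma stestZ r c f : stest r f -> stest r (fun x => c * f x).
Proof. by apply: stestMl; exact: elem_cst. Qed.

Lemma stest_sum r (I : Type) (s : seq I) (F : I -> X -> R) :
  (forall k, stest r (F k)) -> stest r (fun x => \sum_(k <- s) F k x).
Proof.
move=> tF; split; first by apply: elem_sum => k; case: (tF k).
by move=> x xr; rewrite big1// => k _; case: (tF k) => _ ->.
Qed.

Lemma stestX r f n : stest r f -> stest r (fun x => f x ^+ n.+1).
Proof.
by move=> [ef f0]; split; [exact: elem_exp|move=> x /f0->; rewrite expr0n].
Qed.

Lemma stest_bounded r f : 0 <= r -> stest r f -> exists2 M : R, 0 <= M & forall x, `|f x| <= M.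
Proof.
move=> r0 [ef f0].
have b0 : box r 0 by move=> i; rewrite mxE normr0.
have cf : {within box r, continuous (fun x => `|f x|)}.
  apply: continuous_subspaceT => x; apply: continuous_comp; first exact: elem_continuous.
  exact: norm_continuous.
have [c _ fc] := EVT_max_rV (ex_intro _ 0 b0) (@box_compact r) cf.
exists `|f c| => // x; have [xr|/f0 ->] := pselect (box r x); last by rewrite normr0.
by apply: fc; rewrite inE.
Qed.

(** Vanishing near each point outside [D], and not only at it, keeps the closed support inside [D].
    The case of interest is the complement of the origin. *)
Lemma stest_Cc r (D : set X) f : stest r f ->
  (forall x, ~ D x -> \forall y \near x, f y = 0) -> Cc D f.
Proof.
move=> [ef f0] fD.
have sub : fun_support f `<=` box r.
  rewrite [X in _ `<=` X](iffLR (closure_id _) (@box_closed r)).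
  apply: closure_subset => x /= /eqP fx; apply: contrapT => /f0; exact: fx.
split; first exact: elem_continuous.
  by apply: subclosed_compact (@box_compact r) sub; exact: closed_closure.
move=> x xs; apply: contrapT => /fD xf.
by have [y /= [/eqP]] := xs _ xf.
Qed.

Lemma elem_scale c f : elem f -> elem (fun x => f (c *: x)).
Proof.
move=> ef; apply: (elem_comp (L := ( *:%R c) : {linear X -> X})) => //.
exact: scaler_continuous.
Qed.

Lemma derive_scale c f v x : elem f ->
  'D_v (fun x => f (c *: x)) x = c * 'D_v f (c *: x).
Proof.
by move=> ef; rewrite (derive_comp_lin (( *:%R c) : {linear X -> X})) elem_deriveZv.
Qed.

(* Locked: comparing two bumps up to conversion is very slow. *)
Fact bump_key : unit. Proof. exact: tt. Qed.

(** On [box 1] every summand vanishes and the quotient is 1. As soon as some |x_i| exceeds 2, its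
    summand alone reaches [flat 1 3], where 3 = 2^2 - 1, and the outer [flat] returns 0. *)
Definition bump : X -> R := locked_with bump_key (fun x =>
  flat 1 (flat 1 3 - \sum_i flat 1 (x ord0 i ^+ 2 - 1)) / flat 1 (flat 1 3)).

Lemma bumpE : bump = fun x =>
  flat 1 (flat 1 3 - \sum_i flat 1 (x ord0 i ^+ 2 - 1)) / flat 1 (flat 1 3).
Proof. by rewrite /bump unlock. Qed.

Lemma elem_bump : elem bump.
Proof.
rewrite bumpE.
apply: elemM; last exact: elem_cst.
apply: elem_flat; apply: elemB; first exact: elem_cst.
apply: elem_sum => i; apply: elem_flat; apply: elemB; last exact: elem_cst.
by apply: elem_exp; exact: elem_coord.
Qed.

Let kappa_gt0 : 0 < flat 1 (flat 1 (3 : R)).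
Proof. by do 2 apply: flat1_gt0. Qed.

Lemma bump_ge0 x : 0 <= bump x.
Proof. by rewrite bumpE divr_ge0// flat1_ge0. Qed.

Lemma bump_le1 x : bump x <= 1.
Proof.
rewrite bumpE ler_pdivrMr// mul1r flat1_homo// gerBl.
by apply: sumr_ge0 => i _; exact: flat1_ge0.
Qed.

Lemma bump_in x : box 1 x -> bump x = 1.
Proof.
move=> x1; rewrite bumpE big1 ?subr0 ?divff ?gt_eqF// => i _.
by rewrite flat1_le0// subr_le0 -real_normK ?num_real// expr_le1.
Qed.

Lemma bump_out x : ~ box 2 x -> bump x = 0.
Proof.
move=> /existsNP[i /negP]; rewrite -ltNge => xi.
rewrite bumpE flat1_le0 ?mul0r// subr_le0 (bigD1 i)//= ler_wpDr//.
  by apply: sumr_ge0 => j _; exact: flat1_ge0.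
apply: flat1_homo; rewrite -real_normK ?num_real//.
have : 2 ^+ 2 <= `|x ord0 i| ^+ 2 by rewrite lerXn2r ?nnegrE// ltW.
lra.
Qed.

Lemma stest_bump : stest 2 bump.
Proof. by split; [exact: elem_bump|exact: bump_out]. Qed.

Lemma scale_box r s x : 0 < r -> box s (r^-1 *: x) <-> box (s * r) x.
Proof.
move=> r0; split=> xr i; have := xr i.
  by rewrite mxE normrM normfV (gtr0_norm r0) ler_pdivrMl// mulrC.
by rewrite mxE normrM normfV (gtr0_norm r0) ler_pdivrMl// mulrC.
Qed.

Lemma stest_scale r s f : 0 < r -> stest s f ->
  stest (s * r) (fun x => f (r^-1 *: x)).
Proof.
move=> r0 [ef f0]; split; first exact: elem_scale.
by move=> x xr; apply: f0; rewrite scale_box.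
Qed.

Definition bumpr r x := bump (r^-1 *: x).

Lemma bumpr_ge0 r x : 0 <= bumpr r x. Proof. exact: bump_ge0. Qed.

Lemma bumpr_le1 r x : bumpr r x <= 1. Proof. exact: bump_le1. Qed.

Lemma bumpr_in r x : 0 < r -> box r x -> bumpr r x = 1.
Proof. by move=> r0 xr; apply: bump_in; rewrite scale_box// mul1r. Qed.

Lemma stest_bumpr r : 0 < r -> stest (2 * r) (bumpr r).
Proof. by move=> r0; apply: stest_scale => //; exact: stest_bump. Qed.

Lemma elem_bumpr r : elem (bumpr r).
Proof. by apply: elem_scale; exact: elem_bump. Qed.

(** Scaling brings out 1/r; the sum of the bounds over the directions serves as a common
    constant. *)
Lemma derive_bumpr_bound : exists2 M : R, 0 <= M & forall r i x, 0 < r ->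
  `|'D_(dir i) (bumpr r) x| <= M / r.
Proof.
have M i := stest_bounded (ler0n R 2) (stest_derive (dir i) stest_bump).
pose m i := projT1 (cid2 (M i)).
have m0 i : 0 <= m i by rewrite /m; case: cid2.
have mP i x : `|'D_(dir i) bump x| <= m i by rewrite /m; case: cid2 => /= ? _; exact.
exists (\sum_i m i); first exact: sumr_ge0.
move=> r i x r0; rewrite derive_scale; last exact: elem_bump.
rewrite normrM normfV (gtr0_norm r0) mulrC ler_wpM2r ?invr_ge0 ?(ltW r0)//.
by apply: le_trans (mP i _) _; rewrite (bigD1 i)//= lerDl sumr_ge0.
Qed.

Lemma derive_bumpr_out r i x : 0 < r -> ~ box (2 * r) x -> 'D_(dir i) (bumpr r) x = 0.
Proof. by move=> r0; case: (stest_derive (dir i) (stest_bumpr r0)) => _; exact. Qed.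

Lemma derive_bumpr_in r i x : 0 < r -> (forall j, `|x ord0 j| < r) ->
  'D_(dir i) (bumpr r) x = 0.
Proof.
move=> r0 xr; rewrite (near_eq_derive (g := cst (1 : R))) ?derive_cst//.
near=> y; apply: bumpr_in => //; near: y; exact: near_inside_box.
Unshelve. all: by end_near.
Qed.

Definition lap f x := \sum_i 'D_(dir i) ('D_(dir i) f) x.

Lemma stest_lap r f : stest r f -> stest r (lap f).
Proof. by move=> tf; apply: stest_sum => i; do 2 apply: stest_derive. Qed.

Lemma lap_scale c f x : elem f ->
  lap (fun x => f (c *: x)) x = c ^+ 2 * lap f (c *: x).
Proof.
move=> ef; rewrite /lap mulr_sumr; apply: eq_bigr => i _.
rewrite (_ : 'D_(dir i) (fun x => f (c *: x)) = fun y => c * 'D_(dir i) f (c *: y)).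
  rewrite elem_deriveZ; last exact: (elem_scale c (elem_derive (dir i) ef)).
  by rewrite (derive_scale c (dir i) x (elem_derive (dir i) ef)) mulrA.
by apply/funext => y; rewrite derive_scale.
Qed.

(** The Laplacian lives in [box (2 * r)], where the cutoff of radius 2r equals 1. This trades two
    derivatives for the mass on a box twice as large. *)
Lemma lap_bumpr_bound n : exists2 L : R, 0 <= L & forall r x, 0 < r ->
  lap (fun y => bumpr r y ^+ n.+1) x <= L / r ^+ 2 * bumpr (2 * r) x ^+ n.+1.
Proof.
have t2 := stestX n stest_bump.
have [L L0 lL] := stest_bounded (ler0n R 2) (stest_lap t2).
exists L => // r x r0.
have [xr|xr] := pselect (box (2 * r) x); last first.
  have [_ ->//] := stest_lap (stestX n (stest_bumpr r0)).
  by rewrite mulr_ge0 ?divr_ge0 ?exprn_ge0 ?bumpr_ge0// ltW.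
rewrite (bumpr_in _ xr) ?mulr_gt0// expr1n mulr1.
have := @lap_scale r^-1 (fun y => bump y ^+ n.+1) x (elem_exp _ elem_bump).
rewrite /bumpr => ->; rewrite exprVn mulrC ler_wpM2r ?invr_ge0 ?exprn_ge0 ?(ltW r0)//.
exact: le_trans (ler_norm _) (lL _).
Qed.

End spatial_tests.

(** * Lebesgue measure and integrability on boxes *)

Section measure_rV.
Variables (R : realType) (N : nat).
Local Notation X := 'rV[R]_N.
Local Notation mux := (lebesgue_rV R N).
Local Notation mut := (@lebesgue_measure R).
Local Notation mu := (lebesgue_spacetime R N).
Local Notation Z := (X * measurableTypeR R)%type.

(** The sigma-algebra is generated by the coordinates, so a linear form is expanded in them. *)
Lemma measurable_linear_rV (l : {linear X -> R}) : measurable_fun [set: X] l.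
Proof.
rewrite (_ : (l : X -> R) = fun x => \sum_i x ord0 i * l (dir R i)); last first.
  apply/funext => x; rewrite {1}(row_sum_delta x) linear_sum.
  by apply: eq_bigr => i _; rewrite linearZ.
by apply: measurable_sum => i; apply: measurable_funM => //; exact: measurable_rV_coord.
Qed.

Lemma elem_measurable (f : X -> R) : elem f -> measurable_fun [set: X] f.
Proof.
elim=> {f} [c|l cl|f g _ df _ dg|f g _ df _ dg|p f _ df].
- exact: measurable_cst.
- exact: measurable_linear_rV.
- exact: measurable_funD.
- exact: measurable_funM.
- apply: (measurableT_comp _ df); apply: continuous_measurable_fun.
  exact: continuous_flat.
Qed.

Lemma measurable_box r : measurable (box r : set X).
Proof.
rewrite (_ : box r = \bigcap_(i in [set: 'I_N])
    ((fun x : X => x ord0 i) @^-1` `[- r, r]%classic)).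
  apply: fin_bigcap_measurable => // i _.
  by rewrite -[X in measurable X]setTI; exact: measurable_rV_coord.
apply/seteqP; split=> x /= H i => [_|].
  by have := H i; rewrite /= in_itv /= ler_norml.
by have := H i I; rewrite /= in_itv /= ler_norml.
Qed.

Lemma lebesgue_rV_cube r : 0 <= r -> mux (box r) = ((2 * r) ^+ N)%:E.
Proof.
move=> r0.
rewrite (_ : box r = [set x : X | forall i, `[- r, r]%classic (x ord0 i)]); last first.
  by apply/seteqP; split=> x /= H i; have := H i; rewrite /= in_itv /= ler_norml.
rewrite (@lebesgue_rV_box R N (fun=> `[- r, r]%classic))//.
under eq_bigr do rewrite lebesgue_measure_itv/= lte_fin.
have -> : (if - r < r then (r%:E - (- r)%:E)%E else 0%E) = (2 * r)%:E.
  case: ltP => [_|]; first by rewrite -EFinB; congr EFin; lra.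
  by move=> rr; congr EFin; lra.
by rewrite prodEFin prodr_const card_ord.
Qed.

Definition slab r a b : set Z := box r `*` `[a, b]%classic.

Lemma measurable_slab r a b : measurable (slab r a b).
Proof. by apply: measurableX => //; exact: measurable_box. Qed.

Lemma mu_slab r a b : 0 <= r -> a <= b ->
  mu (slab r a b) = ((2 * r) ^+ N * (b - a))%:E.
Proof.
move=> r0 ab; have -> : mu (slab r a b) = (mux (box r) * mut `[a, b]%classic)%E.
  by apply: product_measure1E => //; exact: measurable_box.
rewrite lebesgue_rV_cube// lebesgue_measure_itv /= lte_fin.
case: ltP => [_|ba]; first by rewrite -EFinB EFinM.
have -> : a = b by lra.
by rewrite subrr mulr0 mule0.
Qed.

Lemma measurable_cylinder (T : \bar R) : measurable (cylinder T : set Z).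
Proof.
rewrite (_ : cylinder T = snd @^-1` ([set t | 0 < t] `&` [set t | (t%:E < T)%E])).
  rewrite -[X in measurable X]setTI; apply: measurable_snd => //.
  have -> : [set t : R | 0 < t] = `]0, +oo[%classic.
    by apply/seteqP; split=> t /=; rewrite in_itv/= andbT.
  apply: measurableI => //; case: T => [T| |].
  - have -> : [set t : R | (t%:E < T%:E)%E] = `]-oo, T[%classic.
      by apply/seteqP; split=> t /=; rewrite in_itv/= lte_fin.
    exact: measurable_itv.
  - have -> : [set t : R | (t%:E < +oo)%E] = setT.
      by apply/seteqP; split=> t //= _; exact: ltry.
    exact: measurableT.
  - have -> : [set t : R | (t%:E < -oo)%E] = set0 by apply/seteqP; split=> t /=.
    exact: measurable0.
by apply/seteqP; split.
Qed.

Lemma slab_cylinder (T : \bar R) r a b : 0 < a -> (b%:E < T)%E ->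
  slab r a b `<=` cylinder T.
Proof.
move=> a0 bT [x t] [/= _]; rewrite in_itv/= => /andP[a_t tb].
by split=> /=; [exact: lt_le_trans a_t|exact: le_lt_trans bT].
Qed.

(** Local integrability tested on slabs only, the sets that carry tensor products of a spatial
    cutoff and a function of time. *)
Definition locint (T : \bar R) (h : X * R -> R) :=
  measurable_fun (cylinder T : set Z) (h : Z -> R) /\
  forall r a b, 0 < a -> (b%:E < T)%E -> mu.-integrable (slab r a b) (EFin \o h).

Lemma Lp_loc_locint (T : \bar R) h : Lp_loc_cylinder T 1 h -> locint T h.
Proof.
move=> [mh ih]; split=> // r a b a0 bT.
have sc := @slab_cylinder T r a b a0 bT.
apply/integrableP; split.
  apply/measurable_EFinP.
  by apply: measurable_funS mh => //; exact: measurable_cylinder.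
have := ih (slab r a b); under eq_integral do rewrite powRr1 ?normr_ge0//.
apply; split=> //; apply: compact_setX; first exact: box_compact.
exact: segment_compact.
Qed.

End measure_rV.

(** * Bounded multipliers supported in a given set *)

Section weights.
Context d (S : measurableType d) (R : realType) (nu : {measure set S -> \bar R}).

(** Such a factor turns integrability on [E] into integrability on any larger measurable set.
    Indicators of time windows qualify, as well as smooth cutoffs. *)
Definition weight (E : set S) (g : S -> R) : Prop :=
  [/\ measurable_fun setT g, exists M : R, forall x, `|g x| <= M &
      forall x, ~ E x -> g x = 0].

Lemma integrable_weight (D E : set S) (h g : S -> R) :
  measurable D -> measurable E -> E `<=` D ->
  nu.-integrable E (EFin \o h) -> weight E g ->
  nu.-integrable D (EFin \o (fun x => h x * g x)).
Proof.
move=> mD mE ED ih [mg [M gM] g0].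
apply/(integrable_mkcond _ mD).
rewrite (_ : _ \_ D = (EFin \o (fun x => h x * g x)) \_ E); last first.
  apply/funext => x; rewrite !patchE.
  have [xE|xE] := pselect (E x); first by rewrite !mem_set//; exact: ED.
  by rewrite (memNset xE) /= g0// mulr0; case: ifP.
apply/(integrable_mkcond _ mE).
have := @integrableMl _ _ _ nu E mE (EFin \o h) g ih (measurable_funTS mg) _.
apply; exists M; split; first exact: num_real.
by move=> y My x _; apply: le_trans (gM x) (ltW My).
Qed.

Lemma weightM (E : set S) (f g : S -> R) : measurable_fun setT f ->
  (exists M : R, forall x, `|f x| <= M) -> weight E g -> weight E (fun x => f x * g x).
Proof.
move=> mf [M fM] [mg [K gK] g0]; split.
- exact: measurable_funM.
- exists (M * K) => x; rewrite normrM ler_pM//.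
- by move=> x /g0 ->; rewrite mulr0.
Qed.

Lemma weight_le (E E' : set S) (g : S -> R) : E `<=` E' -> weight E g -> weight E' g.
Proof. by move=> EE [? ? g0]; split=> // x xE; apply: g0 => /EE. Qed.

End weights.

(** * Pairings with products of a function of x and a function of t *)

Section time_slices.
Variables (R : realType) (N : nat) (T : \bar R).
Local Notation X := 'rV[R]_N.
Local Notation mux := (lebesgue_rV R N).
Local Notation mut := (@lebesgue_measure R).
Local Notation mu := (lebesgue_spacetime R N).
Local Notation Z := (X * measurableTypeR R)%type.
Local Notation seg a b := (`[a, b]%classic : set (measurableTypeR R)).

Lemma stest_weight r (f : X -> R) : 0 <= r -> stest r f -> weight (box r) f.
Proof.
move=> r0 tf; have [M _ fM] := stest_bounded r0 tf; have [ef f0] := tf.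
by split=> //; [exact: elem_measurable|exists M].
Qed.

Lemma tens_weight r (a b : R) (f : X -> R) (w : measurableTypeR R -> R) :
  weight (box r) f -> weight (seg a b) w ->
  weight (slab r a b : set Z) (fun z => f z.1 * w z.2).
Proof.
move=> [mf [M fM] f0] [mw [K wK] w0]; split.
- apply: measurable_funM; first exact: (measurableT_comp mf measurable_fst).
  exact: (measurableT_comp mw measurable_snd).
- by exists (M * K) => x; rewrite normrM ler_pM.
- move=> [x t] /= xt; have [xr|/f0->] := pselect (box r x); last by rewrite mul0r.
  by rewrite (w0 t) ?mulr0// => tab; apply: xt.
Qed.

Definition tpairing (h : X * R -> R) (f : X -> R) (w : R -> R) :=
  pairing T h (fun z => f z.1 * w z.2).

Section admissible.
Variables (r a b : R).
Hypotheses (a0 : 0 < a) (bT : (b%:E < T)%E).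

Lemma tens_integrable h f w : locint T h -> weight (box r) f ->
  weight (seg a b) (w : measurableTypeR R -> R) ->
  mu.-integrable (cylinder T) (EFin \o (fun z : Z => h z * (f z.1 * w z.2))).
Proof.
move=> [mh ih] wf ww; apply: (@integrable_weight _ _ _ mu (cylinder T) (slab r a b) h).
- exact: measurable_cylinder.
- exact: measurable_slab.
- exact: slab_cylinder.
- exact: ih.
- exact: tens_weight.
Qed.

(** Dominated convergence, with the absolute value of h f 1_[a,b] as majorant. It will let smooth
    steps in time tend to an indicator. *)
Lemma tpairing_cvg h f (w_ : nat -> R -> R) w : locint T h -> weight (box r) f ->
  (forall n, weight (seg a b) (w_ n : measurableTypeR R -> R)) ->
  weight (seg a b) (w : measurableTypeR R -> R) ->
  (forall n t, `|w_ n t| <= 1) ->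
  (forall t, w_ n t @[n --> \oo] --> w t) ->
  tpairing h f (w_ n) @[n --> \oo] --> tpairing h f w.
Proof.
move=> lh wf ww_ ww w1 wcvg.
pose one t : R := \1_(`[a, b]%classic) t.
have wone : weight (seg a b) (one : measurableTypeR R -> R).
  split; first exact: measurable_indic.
    by exists 1 => t; rewrite /one indicE; case: (_ \in _); rewrite ?normr1 ?normr0.
  by move=> t tab; rewrite /one indicE memNset.
have iw := tens_integrable lh wf ww.
have := @dominated_convergence _ _ _ mu (cylinder T) (@measurable_cylinder R N T)
  (fun n z => (h z * (f z.1 * w_ n z.2))%:E) (fun z => (h z * (f z.1 * w z.2))%:E)
  (fun z => `|h z * (f z.1 * one z.2)|%:E).
case.
- by move=> n; exact: (measurable_int mu (tens_integrable lh wf (ww_ n))).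
- exact: (measurable_int mu iw).
- apply: aeW => z _; apply: cvg_EFin; first by near=> n.
  by apply: cvgMr; apply: cvgMr; exact: wcvg.
- have := integrable_norm (tens_integrable lh wf wone); exact.
- apply: aeW => z n _; rewrite lee_fin !normrM ler_wpM2l// ler_wpM2l//.
  rewrite /one indicE; have [tab|tab] := pselect (`[a, b]%classic z.2).
    by rewrite mem_set// normr1.
  by have [_ _ ->//] := ww_ n; rewrite normr0.
move=> _ _ H.
rewrite /tpairing /pairing /Rintegral; apply: fine_cvg.
rewrite fineK; first exact: H.
by apply: integrable_fin_num => //; exact: measurable_cylinder.
Unshelve. all: by end_near.
Qed.

End admissible.

End time_slices.

(** * Null sets and masses at a fixed time *)

Section slices.
Variables (R : realType) (N : nat) (T : \bar R).
Local Notation X := 'rV[R]_N.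
Local Notation mux := (lebesgue_rV R N).
Local Notation mut := (@lebesgue_measure R).
Local Notation mu := (lebesgue_spacetime R N).
Local Notation Z := (X * measurableTypeR R)%type.
Local Notation seg a b := (`[a, b]%classic : set (measurableTypeR R)).

(** Tonelli for the indicator of a measurable null set containing the exceptional points. *)
Lemma ae_slices (Q : Z -> Prop) : {ae mu, forall z, Q z} ->
  {ae mut, forall t, {ae mux, forall x, Q (x, t)}}.
Proof.
move=> [A [mA A0 QA]].
have H : (\int[mut]_t \int[mux]_x (\1_A (x, t))%:E = 0)%E.
  have mf : measurable_fun setT (EFin \o (\1_A : Z -> R)).
    by apply/measurable_EFinP; exact: measurable_indic.
  rewrite -(@fubini_tonelli2 _ _ _ _ R mux mut (EFin \o (\1_A : Z -> R)) mf); last first.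
    by move=> z; rewrite /= lee_fin.
  transitivity (\int[mu]_z (\1_A z)%:E)%E => //.
  by rewrite integral_indic// setIT.
have mG : measurable_fun setT (fun t : measurableTypeR R => \int[mux]_x (\1_A (x, t))%:E)%E.
  apply: (@measurable_fun_fubini_tonelli_G _ _ _ _ R mux (EFin \o (\1_A : Z -> R))).
    by apply/measurable_EFinP; exact: measurable_indic.
  by move=> z; rewrite /= lee_fin.
have G0 t : (0 <= \int[mux]_x (\1_A (x, t))%:E)%E.
  by apply: integral_ge0 => x _; rewrite lee_fin.
have /(ae_eq_integral_abs mut measurableT mG) : (\int[mut]_t `|\int[mux]_x (\1_A (x, t))%:E| = 0)%E.
  by rewrite -[RHS]H; apply: eq_integral => t _; rewrite gee0_abs.
apply: filterS => t /(_ Logic.I) /= At.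
exists (ysection A t); split; first exact: measurable_ysection.
  rewrite -[RHS]At; transitivity (\int[mux]_x (\1_(ysection A t) x)%:E)%E.
    by rewrite integral_indic ?setIT//; exact: measurable_ysection.
  by apply: eq_integral => x _; rewrite !indicE mem_ysection.
by move=> x /= Qx; rewrite ysectionE /=; apply: QA.
Qed.

Variable v : R -> X -> R.
Hypothesis v_L1 : forall t : R, 0 < t -> (t%:E < T)%E -> L1_loc_space (v t).
Hypothesis v_cont : forall s : R, 0 < s -> (s%:E < T)%E ->
  forall K : set X, compact K ->
    (\int[mux]_(x in K) `|v t x - v s x|) @[t --> s] --> 0.

Definition mass (f : X -> R) (t : R) := \int[mux]_(x in [set: X]) (v t x * f x).

Lemma v_box_integrable t r : 0 < t -> (t%:E < T)%E ->
  mux.-integrable (box r) (EFin \o v t).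
Proof.
move=> t0 tT; have [mv iv] := v_L1 t0 tT.
apply/integrableP; split.
  by apply/measurable_EFinP; exact: measurable_funTS.
have := iv (box r); under eq_integral do rewrite powRr1 ?normr_ge0//.
by apply; split => //; exact: box_compact.
Qed.

Lemma mass_integrable t r f : 0 < t -> (t%:E < T)%E -> weight (box r) f ->
  mux.-integrable [set: X] (EFin \o (fun x => v t x * f x)).
Proof.
move=> t0 tT wf; apply: (@integrable_weight _ _ _ mux setT (box r)) => //.
  exact: measurable_box.
exact: v_box_integrable.
Qed.

Lemma massD t r f g : 0 < t -> (t%:E < T)%E -> weight (box r) f -> weight (box r) g ->
  mass (fun x => f x + g x) t = mass f t + mass g t.
Proof.
move=> t0 tT wf wg; rewrite /mass -RintegralD//; last 2 first.
- exact: mass_integrable wf.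
- exact: mass_integrable wg.
by apply: eq_Rintegral => x _; rewrite mulrDr.
Qed.

Lemma massZ t r c f : 0 < t -> (t%:E < T)%E -> weight (box r) f ->
  mass (fun x => c * f x) t = c * mass f t.
Proof.
move=> t0 tT wf; rewrite /mass -RintegralZl//; last exact: mass_integrable wf.
by apply: eq_Rintegral => x _; rewrite mulrCA.
Qed.

(** The difference of masses is at most a bound of [f] times the L^1 distance of the slices on the
    box. *)
Lemma mass_continuous s r f : 0 < s -> (s%:E < T)%E -> weight (box r) f ->
  mass f t @[t --> s] --> mass f s.
Proof.
move=> s0 sT wf; have [mf [M fM] f0] := wf.
have M0 : 0 <= M by apply: le_trans (fM 0).
apply/cvgrPdist_le => e e0.
(* [M + 1] rather than [M], since [M] may be 0. *)
have e1 : 0 < e / (M + 1) by rewrite divr_gt0// ltr_wpDl.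
have /cvgrPdist_le /(_ _ e1) H := v_cont s0 sT (@box_compact R N r).
have nT : \forall t \near s, (t%:E < T)%E.
  case: T sT => [T' sT|_|//].
    near=> t; rewrite lte_fin; near: t; apply: lt_nbhsl; by rewrite -lte_fin.
  by near=> t; rewrite ltry.
near=> t.
have t0 : 0 < t by near: t; exact: lt_nbhsr.
have tT : (t%:E < T)%E by near: t.
have ifs := mass_integrable s0 sT wf; have ift := mass_integrable t0 tT wf.
have iD : mux.-integrable setT (EFin \o (fun x => v s x * f x - v t x * f x)).
  by have := integrableB measurableT ifs ift; exact: eq_integrable.
rewrite /mass -RintegralB//.
apply: (le_trans (le_normr_Rintegral _ iD)) => //.
have iB : mux.-integrable (box r) (EFin \o (fun x => v t x - v s x)).
  have := integrableB (@measurable_box R N r) (v_box_integrable r t0 tT) (v_box_integrable r s0 sT).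
  by apply: eq_integrable => //; exact: measurable_box.
have iN := integrable_norm iB.
rewrite (_ : Rintegral _ _ _ = \int[mux]_(x in box r) (`|v s x * f x - v t x * f x|)); last first.
  rewrite [RHS]Rintegral_mkcond; apply: eq_Rintegral => x _; rewrite patchE.
  case: ifPn => // /negP; rewrite inE => /f0 ->.
  by rewrite !mulr0 subrr normr0.
apply: (@le_trans _ _ (\int[mux]_(x in box r) (M * `|v t x - v s x|))).
  apply: le_Rintegral; first exact: measurable_box.
  - apply: integrable_norm.
    by apply: (@integrableS _ _ _ mux setT (box r)) => //; exact: measurable_box.
  - have := integrableZl (@measurable_box R N r) M iN.
    by apply: eq_integrable => // ; exact: measurable_box.
  - move=> x _; rewrite -mulrBl normrM distrC mulrC ler_wpM2r//.
rewrite RintegralZl//; last exact: measurable_box.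
have : `|0 - \int[mux]_(x in box r) `|v t x - v s x| | <= e / (M + 1) by near: t.
rewrite sub0r normrN; set I := Rintegral _ _ _ => HI.
have HI' : I <= e / (M + 1) := le_trans (ler_norm _) HI.
apply: (le_trans (ler_wpM2l M0 HI')).
rewrite mulrCA ler_piMr ?(ltW e0)// ler_pdivrMr ?ltr_wpDl// mul1r lerDl//.
Unshelve. all: by end_near.
Qed.

End slices.

(** * Smooth steps in time *)

Section time_step.
Variable R : realType.
Implicit Types (a b h t y c : R).

Definition step y : R := flat 1 (flat 1 1 - flat 1 y) / flat 1 (flat 1 1).

Let K_gt0 : 0 < flat 1 (flat 1 (1 : R)).
Proof. by do 2 apply: flat1_gt0. Qed.

Lemma step_ge0 y : 0 <= step y.
Proof. by rewrite divr_ge0// flat1_ge0. Qed.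

Lemma step_le1 y : step y <= 1.
Proof. by rewrite ler_pdivrMr// mul1r flat1_homo// gerBl flat1_ge0. Qed.

Lemma step_le0 y : y <= 0 -> step y = 1.
Proof. by move=> y0; rewrite /step (flat1_le0 y0) subr0 divff// gt_eqF. Qed.

Lemma step_ge1 y : 1 <= y -> step y = 0.
Proof.
by move=> y1; rewrite /step flat1_le0 ?mul0r// subr_le0; exact: flat1_homo.
Qed.

(** The descent from 1 to 0 takes place to the right of [a], within [[a, a + h]]; as h decreases to
    0 the limit is the indicator of t <= a. *)
Definition tstep a h t := step ((t - a) / h).

Lemma elem_tstep a h : elem (tstep a h : R -> R).
Proof.
apply: elemM; last exact: elem_cst.
apply: elem_flat; apply: elemB; first exact: elem_cst.
apply: elem_flat; apply: elemM; last exact: elem_cst.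
apply: elemB; last exact: elem_cst.
by apply: (@elem_lin R R idfun) => x; exact: cvg_id.
Qed.

Lemma tstep_le a h t : 0 < h -> t <= a -> tstep a h t = 1.
Proof. by move=> h0 ta; rewrite /tstep step_le0// pmulr_lle0 ?invr_gt0// subr_le0. Qed.

Lemma tstep_ge a h t : 0 < h -> a + h <= t -> tstep a h t = 0.
Proof.
by move=> h0 ta; rewrite /tstep step_ge1// ler_pdivlMr// mul1r lerBrDl.
Qed.

(** Sign and support can be read off the formula: both factors [flat (dflat 1)] are nonnegative, one
    vanishes for t <= a and the other for t >= a + h. *)
Lemma derive_tstep a h t : 'D_1 (tstep a h) t =
  - (flat (dflat 1) (flat 1 1 - flat 1 ((t - a) / h)) * flat (dflat 1) ((t - a) / h)
     / h / flat 1 (flat 1 1)).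
Proof.
have e1 : elem (fun t : R => t - a).
  apply: elemB; last exact: elem_cst.
  by apply: (@elem_lin R R idfun) => x; exact: cvg_id.
have e2 : elem (fun t : R => (t - a) / h) by apply: elemM => //; exact: elem_cst.
have e3 : elem (fun t : R => flat 1 ((t - a) / h)) by exact: elem_flat.
have e4 : elem (fun t : R => flat 1 1 - flat 1 ((t - a) / h)).
  by apply: elemB => //; exact: elem_cst.
have e5 := elem_flat 1 e4.
have d2 : 'D_1 (fun t : R => (t - a) / h) t = h^-1.
  rewrite (_ : (fun t : R => _) = fun t => h^-1 * (t + - a)); last first.
    by apply/funext => x; rewrite mulrC.
  rewrite elem_deriveZ//; rewrite elem_deriveD; last 2 first.
  - by apply: (@elem_lin R R idfun) => x; exact: cvg_id.
  - exact: elem_cst.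
  by rewrite derive_cst addr0 derive_id mulr1.
rewrite (_ : tstep a h = fun t => (flat 1 (flat 1 1))^-1 * flat 1 (flat 1 1 - flat 1 ((t - a) / h))); last first.
  by apply/funext => x; rewrite mulrC.
rewrite elem_deriveZ// elem_derive_flat//.
rewrite (_ : (fun t : R => _) = fun t => flat 1 1 + (-1) * flat 1 ((t - a) / h)); last first.
  by apply/funext => x; rewrite mulN1r.
rewrite elem_deriveD; [|exact: elem_cst|exact: elemZ].
by rewrite derive_cst elem_deriveZ// elem_derive_flat// d2; ring.
Qed.

Lemma flat_dflat1_ge0 y : 0 <= flat (dflat (1 : {poly R})) y.
Proof.
rewrite /flat; case: ifP => // _; rewrite mulr_ge0 ?expR_ge0//.
rewrite /dflat (_ : 1^`() = 0 :> {poly R}) ?subr0 ?mulr1; last exact: derivC.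
by rewrite hornerXn sqr_ge0.
Qed.

Lemma derive_tstep_le0 a h t : 0 < h -> 'D_1 (tstep a h) t <= 0.
Proof.
move=> h0; rewrite derive_tstep oppr_le0 !divr_ge0 ?mulr_ge0 ?flat_dflat1_ge0//.
- exact: ltW.
- exact: ltW.
Qed.

Lemma derive_tstep_out a h t : 0 < h -> ~ `[a, a + h]%classic t -> 'D_1 (tstep a h) t = 0.
Proof.
move=> h0 /=; rewrite in_itv/= => /negP; rewrite negb_and -!ltNge => /orP[ta|ta].
  rewrite derive_tstep [X in _ * X / h]/flat ifF ?mulr0 ?mul0r ?oppr0//.
  by apply/negbTE; rewrite -leNgt pmulr_lle0 ?invr_gt0// subr_le0 ltW.
rewrite derive_tstep [X in X * _ / h]/flat ifF ?mul0r ?oppr0//.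
apply/negbTE; rewrite -leNgt subr_le0; apply: flat1_homo.
by rewrite ler_pdivlMr// mul1r lerBrDl ltW.
Qed.

Local Notation mut := (@lebesgue_measure R).

Lemma integral_derive_tstep a h a' b' : 0 < h -> a' <= a -> a + h <= b' ->
  \int[mut]_(t in `[a', b']) 'D_1 (tstep a h) t = -1.
Proof.
move=> h0 aa ab.
have el := elem_tstep a h.
have ab' : a' < b' by rewrite (le_lt_trans aa)// (lt_le_trans _ ab)// ltrDl.
have c1 : {within `[a', b'], continuous ('D_1 (tstep a h))}.
  by apply: continuous_subspaceT; apply: elem_continuous; exact: elem_derive.
have c2 : derivable_oo_LRcontinuous (tstep a h) a' b'.
  split.
  + by move=> x _; exact: elem_derivable.
  + by apply: cvg_at_right_filter; exact: elem_continuous.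
  + by apply: cvg_at_left_filter; exact: elem_continuous.
have c3 : {in `]a', b'[, (tstep a h)^`()%classic =1 'D_1 (tstep a h)}.
  by move=> x _; rewrite derive1E.
have H := continuous_FTC2 ab' c1 c2 c3.
by rewrite /Rintegral H (tstep_le h0 aa) (tstep_ge h0 ab) /= sub0r.
Qed.

(** The opposite of the derivative is nonnegative, has integral 1 and lives in [[a, a + h]]: an
    approximate identity at [a]. *)
Lemma tstep_delta (f : R -> R) (a a' b' c : R) : 0 < c -> a' <= a -> a + c <= b' ->
  (forall t, a' <= t -> t <= b' -> f x @[x --> t] --> f t) ->
  \int[mut]_(t in `[a', b']) (f t * 'D_1 (tstep a (c / n.+1%:R)) t) @[n --> \oo] --> - f a.
Proof.
move=> c0 aa ab cf.
have h0 n : 0 < c / n.+1%:R by rewrite divr_gt0.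
have hc n : c / n.+1%:R <= c by rewrite ler_pdivrMr// ler_peMr ?(ltW c0)// ler1n.
have ab' : a <= b' by apply: le_trans ab; rewrite lerDl ltW.
have cfw : {within `[a', b'], continuous f}.
  apply: continuous_in_subspaceT => t; rewrite inE /= in_itv/= => /andP[? ?]; exact: cf.
have mI : measurable (`[a', b']%classic : set (measurableTypeR R)) by exact: measurable_itv.
apply/cvgrPdist_le => e e0.
have /cvgrPdist_le /(_ _ e0) [d /= d0 fd] := cf a aa ab'.
near=> n.
set h := c / n.+1%:R.
have hd : h < d.
  rewrite /h ltr_pdivrMr// mulrC -ltr_pdivrMr//.
  near: n; apply: (@filterS _ _ _ [set n | c / d < n%:R]).
    by move=> n /= H; apply: (lt_le_trans H); rewrite ler_nat.
  exact: nbhs_infty_gtr.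
have ck : {within `[a', b'], continuous ('D_1 (tstep a h))}.
  by apply: continuous_subspaceT; apply: elem_continuous; apply: elem_derive; exact: elem_tstep.
have ik : mut.-integrable `[a', b'] (EFin \o 'D_1 (tstep a h)).
  by apply: continuous_compact_integrable => //; exact: segment_compact.
have ifk : mut.-integrable `[a', b'] (EFin \o (fun t => f t * 'D_1 (tstep a h) t)).
  apply: continuous_compact_integrable; first exact: segment_compact.
  by move=> x; apply: cvgM; [exact: cfw|exact: ck].
have ifk2 : mut.-integrable `[a', b'] (EFin \o (fun t => f a * 'D_1 (tstep a h) t)).
  by have := integrableZl mI (f a) ik; apply: eq_integrable.
have hb : a + h <= b' by apply: le_trans ab; rewrite lerD2l; exact: hc.
have -> : - f a = \int[mut]_(t in `[a', b']) (f a * 'D_1 (tstep a h) t).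
  by rewrite RintegralZl// (integral_derive_tstep (h0 n) aa hb) mulrN1.
rewrite -RintegralB//.
have iD : mut.-integrable `[a', b'] (EFin \o (fun t => f a * 'D_1 (tstep a h) t - f t * 'D_1 (tstep a h) t)).
  by have := integrableB mI ifk2 ifk; apply: eq_integrable.
apply: (le_trans (le_normr_Rintegral _ iD)) => //.
have iE : mut.-integrable `[a', b'] (EFin \o (fun t => - e * 'D_1 (tstep a h) t)).
  by have := integrableZl mI (- e) ik; apply: eq_integrable.
apply: (@le_trans _ _ (\int[mut]_(t in `[a', b']) (- e * 'D_1 (tstep a h) t))).
  apply: le_Rintegral => //; first exact: integrable_norm.
  move=> t /= tab; rewrite -mulrBl normrM.
  have [tah|tah] := pselect (`[a, a + h]%classic t); last first.
    by rewrite (derive_tstep_out (h0 n) tah) normr0 !mulr0.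
  rewrite (ler0_norm (derive_tstep_le0 _ _ (h0 n))) mulrN mulNr lerN2.
  apply: (ler_wnM2r (derive_tstep_le0 a t (h0 n))); apply: (fd t) => /=.
  move: tah; rewrite /= in_itv/= => /andP[at_ tah].
  by rewrite distrC ger0_norm ?subr_ge0// ltrBlDl (le_lt_trans tah)// ltrD2l.
by rewrite RintegralZl// (integral_derive_tstep (h0 n) aa hb) mulrN1 opprK.
Unshelve. all: by end_near.
Qed.

Lemma tstep_cvg a c t : 0 < c ->
  tstep a (c / n.+1%:R) t @[n --> \oo] --> ((t <= a)%R%:R : R).
Proof.
move=> c0; have h0 n : 0 < c / n.+1%:R by rewrite divr_gt0.
have [ta|ta] := leP t a.
  under eq_fun do rewrite tstep_le//; exact: cvg_cst.
apply: cvg_near_cst; near=> n; apply: tstep_ge => //.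
rewrite -lerBrDl ler_pdivrMr// mulrC -ler_pdivrMr ?subr_gt0//.
near: n; apply: (@filterS _ _ _ [set n | c / (t - a) < n%:R]).
  by move=> n /= /ltW H; apply: (le_trans H); rewrite ler_nat.
exact: nbhs_infty_gtr.
Unshelve. all: by end_near.
Qed.

End time_step.

(** * Energy identities between two times *)

Section tensor_tests.
Variables (R : realType) (N : nat).
Local Notation X := 'rV[R]_N.

Lemma fst_continuous (V W : normedModType R) : continuous (fst : V * W -> V).
Proof. by move=> x; exact: cvg_fst. Qed.

Lemma snd_continuous (V W : normedModType R) : continuous (snd : V * W -> W).
Proof. by move=> x; exact: cvg_snd. Qed.

Definition tens (f : X -> R) (w : R -> R) (z : X * R) := f z.1 * w z.2.

Variables (f : X -> R) (w : R -> R).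
Hypotheses (ef : elem f) (ew : elem (w : R -> R)).

Let ef1 : elem (fun z : X * R => f z.1).
Proof. exact: (elem_comp (L := fst : {linear (X * R)%type -> X}) (@fst_continuous _ _) ef). Qed.

Let ew2 : elem (fun z : X * R => w z.2).
Proof. exact: (elem_comp (L := snd : {linear (X * R)%type -> R}) (@snd_continuous _ _) ew). Qed.

Lemma elem_tens : elem (tens f w). Proof. exact: elemM. Qed.

Lemma partial_x_tens i : partial_x i (tens f w) = tens ('D_(dir R i) f) w.
Proof.
apply/funext => z; rewrite /partial_x elem_deriveM//.
rewrite (derive_comp_lin (fst : {linear (X * R)%type -> X})).
rewrite (derive_comp_lin (snd : {linear (X * R)%type -> R})) /=.
by rewrite derive0 mulr0 add0r mulrC.
Qed.

Lemma partial_t_tens : partial_t (tens f w) = tens f ('D_1 w).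
Proof.
apply/funext => z; rewrite /partial_t elem_deriveM//.
rewrite (derive_comp_lin (fst : {linear (X * R)%type -> X})).
rewrite (derive_comp_lin (snd : {linear (X * R)%type -> R})) /=.
by rewrite derive0 mulr0 addr0.
Qed.

End tensor_tests.

Section laplacian_of_tensors.
Variables (R : realType) (N : nat).
Local Notation X := 'rV[R]_N.

Lemma laplacian_tens (f : X -> R) (w : R -> R) : elem f -> elem (w : R -> R) ->
  laplacian (tens f w) = tens (lap f) w.
Proof.
move=> ef ew; apply/funext => z; rewrite /laplacian /tens /lap mulr_suml.
by apply: eq_bigr => i _; rewrite !partial_x_tens//; exact: elem_derive.
Qed.

Lemma tens_test (T : \bar R) r a b (f : X -> R) (w : R -> R) :
  0 < a -> (b%:E < T)%E -> stest r f -> elem (w : R -> R) ->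
  (forall t, ~ `[a, b]%classic t -> w t = 0) -> test_function (cylinder T) (tens f w).
Proof.
move=> a0 bT [ef f0] ew w0; have et := elem_tens ef ew.
have cK : compact (box r `*` `[a, b]%classic : set (X * R)).
  by apply: compact_setX; [exact: box_compact|exact: segment_compact].
have clK : closed (box r `*` `[a, b]%classic : set (X * R)).
  by apply: compact_closed => //; exact: norm_hausdorff.
have sub : fun_support (tens f w) `<=` box r `*` `[a, b]%classic.
  rewrite [X in _ `<=` X](iffLR (closure_id _) clK).
  apply: closure_subset => -[x t] /= /eqP; apply: contra_notP => /not_andP[/f0|/w0]; rewrite /tens /= => ->.
    by rewrite mul0r.
  by rewrite mulr0.
split; first exact: elem_smooth.
split; first exact: elem_continuous.
  by apply: subclosed_compact cK sub; exact: closed_closure.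
apply: subset_trans sub _ => -[x t] [/= _]; rewrite in_itv/= => /andP[a_t tb].
by split=> /=; [exact: lt_le_trans a_t|exact: le_lt_trans bT].
Qed.

End laplacian_of_tensors.

(** * From test functions to identities on a time window *)

Section identities.
Variables (R : realType) (N : nat) (T : \bar R) (q : R).
Local Notation X := 'rV[R]_N.
Local Notation mux := (lebesgue_rV R N).
Local Notation mut := (@lebesgue_measure R).
Local Notation mu := (lebesgue_spacetime R N).
Local Notation Z := (X * measurableTypeR R)%type.
Local Notation seg a b := (`[a, b]%classic : set (measurableTypeR R)).
Variables (u : X * R -> R) (Du : X * R -> X) (v : R -> X -> R).
Hypothesis hu : locint T u.
Hypothesis hDu : is_weak_gradient T u Du.
Let g z := euclidean_norm (Du z) `^ q.
Hypothesis hg : locint T g.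
Hypothesis hHJ : viscous_HJ T q u Du.
Hypothesis hv : continuous_representative T u v.

Let v_L1 : forall t : R, 0 < t -> (t%:E < T)%E -> L1_loc_space (v t).
Proof. by case: hv. Qed.

Let v_cont : forall s : R, 0 < s -> (s%:E < T)%E ->
  forall K : set X, compact K ->
    (\int[mux]_(x in K) `|v t x - v s x|) @[t --> s] --> 0.
Proof. by case: hv. Qed.

Lemma Du_locint i : locint T (fun z => Du z ord0 i).
Proof. by have [H _] := hDu i; exact: Lp_loc_locint. Qed.

Lemma mass_within_continuous r (f : X -> R) a b : 0 < a -> (b%:E < T)%E ->
  weight (box r) f -> {within `[a, b], continuous (mass v f)}.
Proof.
move=> a0 bT wf; apply: continuous_in_subspaceT => t; rewrite inE /= in_itv/= => /andP[a_t tb].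
apply: (mass_continuous v_L1 v_cont) wf; first exact: lt_le_trans a_t.
by apply: le_lt_trans bT; rewrite lee_fin.
Qed.

(** Fubini reduces the pairing to slices, and for almost every time the slice of [u] agrees almost
    everywhere with that of the continuous representative. *)
Lemma Fubini_tpairing r (f : X -> R) (w : R -> R) a b : 0 < a -> (b%:E < T)%E ->
  weight (box r) f -> weight (seg a b) (w : measurableTypeR R -> R) ->
  tpairing T u f w = \int[mut]_(t in seg a b) (mass v f t * w t).
Proof.
move=> a0 bT wf ww.
have ik := tens_integrable a0 bT hu wf ww.
have mC := @measurable_cylinder R N T.
set k := EFin \o _ in ik.
have ik' : mu.-integrable setT (k \_ (cylinder T)) by apply/(integrable_mkcond _ mC).
have mk' : measurable_fun setT (k \_ (cylinder T) : Z -> \bar R) := measurable_int mu ik'.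
rewrite /tpairing /pairing /Rintegral; congr fine.
rewrite -/k integral_mkcond.
have := @integral21_prod_meas1 _ _ _ _ R mux mut (k \_ (cylinder T)) ik'.
move=> E; transitivity (\int[(mux \x mut)%E]_z (k \_ (cylinder T)) z)%E; first by [].
rewrite -E => {E}.
pose G t := (\int[mux]_x (k \_ (cylinder T)) (x, t))%E.
have mG : measurable_fun setT (G : measurableTypeR R -> \bar R).
  exact: (@measurable_fubini_G _ _ _ _ R mux mut _ ik').
transitivity (\int[mut]_(t in seg a b) G t)%E.
  rewrite [RHS]integral_mkcond; apply: eq_integral => t _; rewrite patchE.
  case: ifPn => // /negP; rewrite inE => tab; apply: integral0_eq => x _.
  rewrite patchE; case: ifP => // _; rewrite /k /=.
  by have [_ _ ->//] := ww; rewrite !mulr0.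
have [mw _ _] := ww.
apply: ae_eq_integral.
- exact: measurable_itv.
- exact: measurable_funTS.
- apply/measurable_EFinP; apply: measurable_funM; last exact: measurable_funTS.
  apply: subspace_continuous_measurable_fun; first exact: measurable_itv.
  exact: (mass_within_continuous a0 bT wf).
have [vu _ _] := hv; have := ae_slices vu.
apply: filterS => t vut; rewrite /= in_itv/= => /andP[a_t tb].
have t0 : 0 < t := lt_le_trans a0 a_t.
have tT : (t%:E < T)%E by apply: le_lt_trans bT; rewrite lee_fin.
have ivf := mass_integrable v_L1 t0 tT wf.
rewrite /mass -(RintegralZr (w t) measurableT ivf) /Rintegral fineK; last first.
  apply: integrable_fin_num => //.
  by have := integrableZr measurableT (w t) ivf; apply: eq_integrable.
apply: ae_eq_integral => //.
- exact: (measurableT_comp mk' (pair2_measurable t)).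
- apply/measurable_EFinP; apply: measurable_funM => //.
  by apply/measurable_EFinP; exact: (measurable_int mux ivf).
apply: filterS vut => x vux _; rewrite patchE mem_set//= /k /= mulrA.
by rewrite (vux (conj t0 tT)).
Qed.


Section tpairing_linear.
Variables (r a b : R) (h : X * R -> R) (w : R -> R).
Hypotheses (a0 : 0 < a) (bT : (b%:E < T)%E) (lh : locint T h).
Hypothesis ww : weight (seg a b) (w : measurableTypeR R -> R).

Lemma tpairingD f1 f2 : weight (box r) f1 -> weight (box r) f2 ->
  tpairing T h (fun x : X => f1 x + f2 x) w = tpairing T h f1 w + tpairing T h f2 w.
Proof.
move=> w1 w2; rewrite /tpairing /pairing -RintegralD.
- by apply: eq_Rintegral => z _; rewrite mulrDl mulrDr.
- exact: measurable_cylinder.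
- exact: (tens_integrable a0 bT lh w1 ww).
- exact: (tens_integrable a0 bT lh w2 ww).
Qed.

Lemma tpairingZ c f1 : weight (box r) f1 ->
  tpairing T h (fun x : X => c * f1 x) w = c * tpairing T h f1 w.
Proof.
move=> w1; rewrite /tpairing /pairing -RintegralZl.
- by apply: eq_Rintegral => z _; rewrite -mulrA mulrCA.
- exact: measurable_cylinder.
- exact: (tens_integrable a0 bT lh w1 ww).
Qed.

End tpairing_linear.

Lemma weight0 (E : set X) : weight E (fun=> 0 : R).
Proof. by split => //; exists 0 => x; rewrite normr0. Qed.

Lemma weightD (E : set X) (f1 f2 : X -> R) : weight E f1 -> weight E f2 ->
  weight E (fun x => f1 x + f2 x).
Proof.
move=> [m1 [M1 b1] z1] [m2 [M2 b2] z2]; split; first exact: measurable_funD.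
  by exists (M1 + M2) => x; apply: le_trans (ler_normD _ _) (lerD _ _).
by move=> x xE; rewrite z1// z2// addr0.
Qed.

Lemma weight_sum (E : set X) (I : Type) (l : seq I) (f_ : I -> X -> R) :
  (forall i, weight E (f_ i)) -> weight E (fun x => \sum_(i <- l) f_ i x).
Proof.
move=> wf; elim: l => [|i l IH].
  by under eq_fun do rewrite big_nil; exact: weight0.
by under eq_fun do rewrite big_cons; exact: weightD.
Qed.

Lemma tpairing_sum r a b h (w : R -> R) (I : Type) (l : seq I) (f_ : I -> X -> R) :
  0 < a -> (b%:E < T)%E -> locint T h ->
  weight (seg a b) (w : measurableTypeR R -> R) ->
  (forall i, weight (box r) (f_ i)) ->
  tpairing T h (fun x => \sum_(i <- l) f_ i x) w = \sum_(i <- l) tpairing T h (f_ i) w.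
Proof.
move=> a0 bT lh ww wf; elim: l => [|i l IH].
  rewrite big_nil; under eq_fun do rewrite big_nil.
  by rewrite /tpairing /pairing; under eq_Rintegral do rewrite mul0r mulr0; rewrite /Rintegral integral0.
rewrite big_cons -IH; under eq_fun do rewrite big_cons.
by rewrite (tpairingD a0 bT lh ww (wf i) (weight_sum l wf)).
Qed.

(** Half-open because it is the pointwise limit of [tstep t h - tstep s h] as h decreases to 0. *)
Definition win (s t x : R) : R := \1_(`]s, t]%classic) x.

Lemma win_ge0 s t x : 0 <= win s t x. Proof. by rewrite /win indicE. Qed.

Lemma win_weight s t b : t <= b -> weight (seg s b) (win s t : measurableTypeR R -> R).
Proof.
move=> tb; split.
- by apply: measurable_indic; exact: measurable_itv.
- by exists 1 => x; rewrite /win indicE; case: (_ \in _); rewrite ?normr1 ?normr0.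
- move=> x /= xs; rewrite /win indicE memNset//= in_itv/= => /andP[sx xt].
  by apply: xs; rewrite in_itv/= (ltW sx) (le_trans xt).
Qed.

Lemma continuous_seg_weight a b (w : R -> R) : continuous w ->
  (forall x, ~ `[a, b]%classic x -> w x = 0) ->
  weight (seg a b) (w : measurableTypeR R -> R).
Proof.
move=> cw w0; split => //; first exact: continuous_measurable_fun.
have [ab|ba] := leP a b; last first.
  exists 0 => x; rewrite w0 ?normr0//= in_itv/= => /andP[ax xb].
  by have := le_lt_trans (le_trans ax xb) ba; rewrite ltxx.
have cn : {within `[a, b], continuous (fun x => `|w x|)}.
  by apply: continuous_subspaceT => x; apply: continuous_comp; [exact: cw|exact: norm_continuous].
have [c _ wc] := EVT_max ab cn; exists `|w c| => x.
have [xab|/w0->] := pselect (`[a, b]%classic x); last by rewrite normr0.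
exact: wc.
Qed.

Section passage.
Variables (s t c : R).
Hypotheses (s0 : 0 < s) (st : s <= t) (c0 : 0 < c) (tcT : ((t + c)%:E < T)%E).
Let hn n := c / n.+1%:R.
Let th n x := tstep t (hn n) x - tstep s (hn n) x.

Let hn0 n : 0 < hn n. Proof. by rewrite divr_gt0. Qed.

Let hnc n : hn n <= c. Proof. by rewrite ler_pdivrMr// ler_peMr ?(ltW c0)// ler1n. Qed.

Let eth n : elem (th n : R -> R).
Proof. by apply: elemB; exact: elem_tstep. Qed.

Let th_out n x : ~ `[s, t + c]%classic x -> th n x = 0.
Proof.
rewrite /= in_itv/= => /negP; rewrite negb_and -!ltNge => /orP[xs|xt].
  by rewrite /th !tstep_le ?subrr// ltW// (lt_le_trans xs).
rewrite /th !tstep_ge ?subrr//.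
  by rewrite (le_trans _ (ltW xt))// lerD.
by rewrite (le_trans _ (ltW xt))// lerD.
Qed.

Let th_le1 n x : `|th n x| <= 1.
Proof.
rewrite ler_norml /th /tstep.
have := step_ge0 ((x - t) / hn n); have := step_le1 ((x - t) / hn n).
have := step_ge0 ((x - s) / hn n); have := step_le1 ((x - s) / hn n).
by move=> *; apply/andP; split; lra.
Qed.

Let th_weight n : weight (seg s (t + c)) (th n : measurableTypeR R -> R).
Proof.
by apply: continuous_seg_weight; [apply: elem_continuous; exact: eth|exact: th_out].
Qed.

Let th_cvg x : th n x @[n --> \oo] --> win s t x.
Proof.
have -> : win s t x = (x <= t)%R%:R - (x <= s)%R%:R.
  rewrite /win indicE; have -> : (x \in `]s, t]%classic) = (s < x <= t).
    by apply/idP/idP; rewrite inE /= in_itv.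
  case: (leP x s) => [xs|_]; last by rewrite subr0.
  by rewrite (le_trans xs st) subrr.
by apply: cvgB; exact: tstep_cvg.
Qed.

Let tpairing_th_cvg r h (f : X -> R) : locint T h -> weight (box r) f ->
  tpairing T h f (th n) @[n --> \oo] --> tpairing T h f (win s t).
Proof.
move=> lh wf; apply: (tpairing_cvg s0 tcT lh wf) => //.
by apply: win_weight; rewrite lerDl ltW.
Qed.

Lemma weak_grad_margin r (f : X -> R) i : 0 <= r -> stest r f ->
  tpairing T u ('D_(dir R i) f) (win s t) = - tpairing T (fun z => Du z ord0 i) f (win s t).
Proof.
move=> r0 tf; have ef := stest_elem tf.
have c1 := tpairing_th_cvg hu (stest_weight r0 (stest_derive (dir R i) tf)).
have c2 : - tpairing T (fun z => Du z ord0 i) f (th n) @[n --> \oo] -->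
    - tpairing T (fun z => Du z ord0 i) f (win s t).
  by apply: cvgN; exact: tpairing_th_cvg (Du_locint i) (stest_weight r0 tf).
have E n : tpairing T u ('D_(dir R i) f) (th n) = - tpairing T (fun z => Du z ord0 i) f (th n).
  have [_ H] := hDu i.
  have := H _ (tens_test s0 tcT tf (eth n) (th_out n)).
  by rewrite (partial_x_tens ef (eth n)).
have {}c1 : - tpairing T (fun z => Du z ord0 i) f (th n) @[n --> \oo] -->
    tpairing T u ('D_(dir R i) f) (win s t) by under eq_fun do rewrite -E.
by rewrite -(cvg_lim (@Rhausdorff R) c1) (cvg_lim (@Rhausdorff R) c2).
Qed.

(** Tested with f times [th n], the time derivative concentrates at [s] and [t] and produces the two
    masses by [tstep_delta]; the other pairings converge by domination. *)
Lemma energy_margin r (f : X -> R) : 0 <= r -> stest r f ->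
  mass v f t - mass v f s = tpairing T u (lap f) (win s t) - tpairing T g f (win s t).
Proof.
move=> r0 tf; have ef := stest_elem tf; have wf := stest_weight r0 tf.
have c1 := tpairing_th_cvg hu (stest_weight r0 (stest_lap tf)).
have c2 := tpairing_th_cvg hg wf.
have sc : s < t + c by apply: le_lt_trans st _; rewrite ltrDl.
have cF x : s <= x -> x <= t + c -> mass v f y @[y --> x] --> mass v f x.
  move=> sx xt; apply: (mass_continuous v_L1 v_cont _ _ wf); first exact: lt_le_trans sx.
  by apply: le_lt_trans tcT; rewrite lee_fin.
have d1 := tstep_delta c0 st (lexx (t + c)) cF.
have sctc : s + c <= t + c by rewrite lerD2r.
have d2 := tstep_delta c0 (lexx s) sctc cF.
have E n : tpairing T u f ('D_1 (th n)) = - (tpairing T u (lap f) (th n) - tpairing T g f (th n)).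
  have := hHJ (tens_test s0 tcT tf (eth n) (th_out n)).
  rewrite (partial_t_tens ef (eth n)) (laplacian_tens ef (eth n)).
  rewrite -[pairing T u (tens f _)]/(tpairing T u f ('D_1 (th n))).
  rewrite -[pairing T u (tens (lap f) _)]/(tpairing T u (lap f) (th n)).
  rewrite -[pairing T _ (tens f _)]/(tpairing T g f (th n)).
  by move=> H; lra.
have E' n : tpairing T u f ('D_1 (th n)) =
    \int[mut]_(x in `[s, t + c]) (mass v f x * 'D_1 (tstep t (hn n)) x) -
    \int[mut]_(x in `[s, t + c]) (mass v f x * 'D_1 (tstep s (hn n)) x).
  have edt := elem_derive (1 : R) (elem_tstep t (hn n)).
  have eds := elem_derive (1 : R) (elem_tstep s (hn n)).
  have Dth x : 'D_1 (th n) x = 'D_1 (tstep t (hn n)) x - 'D_1 (tstep s (hn n)) x.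
    by rewrite /th deriveB//; apply: elem_derivable; exact: elem_tstep.
  have ww : weight (seg s (t + c)) ('D_1 (th n) : measurableTypeR R -> R).
    apply: continuous_seg_weight; first by apply: elem_continuous; exact: elem_derive.
    move=> x /= xst; rewrite Dth !derive_tstep_out ?subrr//.
      by move=> /=; rewrite in_itv/= => /andP[sx xs]; apply: xst; rewrite in_itv/= sx (le_trans xs) ?lerD.
    move=> /=; rewrite in_itv/= => /andP[tx xt]; apply: xst.
    by rewrite in_itv/= (le_trans st tx) (le_trans xt) ?lerD2l.
  have ifk (k : R -> R) : continuous k -> mut.-integrable (seg s (t + c)) (EFin \o (fun x => mass v f x * k x)).
    move=> ck; apply: continuous_compact_integrable; first exact: segment_compact.
    move=> x; apply: cvgM; first exact: (mass_within_continuous s0 tcT wf).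
    exact: (@continuous_subspaceT _ _ _ k ck).
  rewrite (Fubini_tpairing s0 tcT wf ww) -RintegralB//.
  - by apply: eq_Rintegral => x _; rewrite Dth mulrBr.
  - exact: ifk (elem_continuous edt).
  - exact: ifk (elem_continuous eds).
have c3 : tpairing T u f ('D_1 (th n)) @[n --> \oo] --> - mass v f t - - mass v f s.
  by under eq_fun do rewrite E'; exact: cvgB d1 d2.
have c4 : tpairing T u f ('D_1 (th n)) @[n --> \oo] -->
    - (tpairing T u (lap f) (win s t) - tpairing T g f (win s t)).
  by under eq_fun do rewrite E; apply: cvgN; exact: cvgB c1 c2.
have : - mass v f t - - mass v f s = - (tpairing T u (lap f) (win s t) - tpairing T g f (win s t)).
  by rewrite -(cvg_lim (@Rhausdorff R) c3) (cvg_lim (@Rhausdorff R) c4).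
by move=> H; lra.
Qed.

End passage.

(** Room after [t] for the descending step, available because the time interval is open. *)
Lemma time_margin t : (t%:E < T)%E -> exists2 c, 0 < c & ((t + c)%:E < T)%E.
Proof.
case: T => [T'| |//] tT; last by exists 1 => //; rewrite ltry.
move: tT; rewrite lte_fin => tT; exists ((T' - t) / 2); first lra.
by rewrite lte_fin; lra.
Qed.

Lemma locint1 : @locint R N T (fun=> 1).
Proof.
split; first exact: measurable_cst.
move=> r a b a0 bT; apply: measurable_bounded_integrable => //.
- exact: measurable_slab.
- have [ab|ba] := leP a b; last first.
    rewrite (_ : slab r a b = set0) ?measure0//.
    apply/seteqP; split=> // -[x t] [_ /=]; rewrite in_itv/= => /andP[at_ tb].
    by have := le_lt_trans (le_trans at_ tb) ba; rewrite ltxx.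
  have [r0|r0] := leP 0 r; first by rewrite mu_slab// ltry.
  apply: (@le_lt_trans _ _ (mu (slab 0 a b))); last by rewrite mu_slab// ltry.
  apply: le_measure; rewrite ?inE; try exact: measurable_slab.
  by move=> [x t] [xr tab]; split=> //; apply: box_le xr; exact: ltW.
- exact: bounded_cst.
Qed.

Lemma box_weight r : weight (box r) (\1_(box r) : X -> R).
Proof.
split.
- by apply: measurable_indic; exact: measurable_box.
- by exists 1 => x; rewrite indicE; case: (_ \in _); rewrite ?normr1 ?normr0.
- by move=> x xr; rewrite indicE memNset.
Qed.

(** * Estimates over a time window *)

Section window.
Variables (s t : R).
Hypotheses (s0 : 0 < s) (st : s <= t) (tT : (t%:E < T)%E).
Let ww : weight (seg s t) (win s t : measurableTypeR R -> R).
Proof. exact: win_weight. Qed.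

Lemma weak_grad r (f : X -> R) i : 0 <= r -> stest r f ->
  tpairing T u ('D_(dir R i) f) (win s t) = - tpairing T (fun z => Du z ord0 i) f (win s t).
Proof. by have [c c0 tc] := time_margin tT; exact: (weak_grad_margin s0 st c0 tc). Qed.

Lemma energy r (f : X -> R) : 0 <= r -> stest r f ->
  mass v f t - mass v f s = tpairing T u (lap f) (win s t) - tpairing T g f (win s t).
Proof. by have [c c0 tc] := time_margin tT; exact: (energy_margin s0 st c0 tc). Qed.

(** One integration by parts leaves first derivatives only, the form to which Young's inequality
    applies. *)
Lemma energy_grad r (f : X -> R) : 0 <= r -> stest r f ->
  mass v f t - mass v f s =
  - (\sum_i tpairing T (fun z => Du z ord0 i) ('D_(dir R i) f) (win s t)) - tpairing T g f (win s t).
Proof.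
move=> r0 tf; rewrite (energy r0 tf); congr (_ - _).
rewrite /lap (tpairing_sum _ s0 tT hu ww (r := r)); last first.
  by move=> i; apply: stest_weight => //; do 2 apply: stest_derive.
rewrite -sumrN; apply: eq_bigr => i _.
by rewrite (weak_grad _ r0)//; exact: stest_derive.
Qed.

Lemma tpairing_one_box r : 0 <= r ->
  tpairing T (fun=> 1) (\1_(box r) : X -> R) (win s t) = (2 * r) ^+ N * (t - s).
Proof.
move=> r0; rewrite /tpairing /pairing.
pose A : set Z := box r `*` (`]s, t]%classic : set (measurableTypeR R)).
have mA : measurable A by apply: measurableX => //; exact: measurable_box.
rewrite (_ : Rintegral _ _ _ = \int[mu]_(z in cylinder T) (\1_A z)); last first.
  apply: eq_Rintegral => z _; rewrite mul1r /win !indicE /A in_setX.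
  by case: (_ \in _); case: (_ \in _); rewrite ?mulr0 ?mul0r ?mulr1.
rewrite /Rintegral integral_indic//; last exact: measurable_cylinder.
rewrite setIidl; last first.
  move=> [x y] [/= _]; rewrite in_itv/= => /andP[sy yt]; split => /=.
    exact: lt_trans sy.
  by apply: le_lt_trans tT; rewrite lee_fin.
have -> : mu A = (mux (box r) * mut `]s, t]%classic)%E.
  by apply: product_measure1E => //; exact: measurable_box.
rewrite lebesgue_rV_cube// lebesgue_measure_itv /= lte_fin.
case: ltP => [_|ts]; first by rewrite -EFinB -EFinM.
have -> : s = t by apply/le_anti; rewrite st ts.
by rewrite subrr mulr0 mule0.
Qed.

Lemma tpairing_u_le r (f : X -> R) C : weight (box r) f ->
  (forall x, s < x -> x <= t -> mass v f x <= C) -> tpairing T u f (win s t) <= C * (t - s).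
Proof.
move=> wf FC; rewrite (Fubini_tpairing s0 tT wf ww).
have mS : measurable (seg s t) by exact: measurable_itv.
have iw : mut.-integrable (seg s t) (EFin \o win s t).
  apply: (@integrableS _ _ _ mut setT) => //.
  by apply: integrable_indic_itv.
have cF := mass_within_continuous s0 tT wf.
have iF : mut.-integrable (seg s t) (EFin \o mass v f).
  by apply: continuous_compact_integrable => //; exact: segment_compact.
have iFw : mut.-integrable (seg s t) (EFin \o (fun x => mass v f x * win s t x)).
  have := @integrableMl _ _ _ mut (seg s t) mS _ (win s t) iF _ _; apply.
    by have [mw _ _] := ww; exact: measurable_funTS.
  exists 1; split; first exact: num_real.
  move=> y y1 x _; rewrite /= ger0_norm ?win_ge0//; apply: le_trans (ltW y1).
  by rewrite /win indicE; case: (_ \in _).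
have iCw : mut.-integrable (seg s t) (EFin \o (fun x => C * win s t x)).
  by have := integrableZl mS C iw; apply: eq_integrable.
apply: (@le_trans _ _ (\int[mut]_(x in seg s t) (C * win s t x))).
  apply: le_Rintegral => // x _; rewrite /win indicE.
  have [|] := boolP (x \in `]s, t]%classic); last by rewrite !mulr0.
  by rewrite inE /= in_itv/= => /andP[sx xt]; rewrite !mulr1; exact: FC.
rewrite RintegralZl// /Rintegral /win integral_indic// setIidl; last first.
  by move=> x /=; rewrite !in_itv/= => /andP[/ltW -> ->].
suff E : fine (mut `]s, t]%classic) = t - s by rewrite -E.
rewrite lebesgue_measure_itv /= lte_fin.
case: ltP => [_|ts] //.
have -> : s = t by apply/le_anti; rewrite st ts.
by rewrite subrr.
Qed.

Lemma tpairing_u_ge r (f : X -> R) C : weight (box r) f ->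
  (forall x, s < x -> x <= t -> C <= mass v f x) -> C * (t - s) <= tpairing T u f (win s t).
Proof.
move=> wf FC.
have wN : weight (box r) (fun x => -1 * f x).
  by apply: (@weightM _ _ _ (box r) (fun=> -1)) wf => //; exists 1 => x; rewrite normrN1.
have FN x : s < x -> x <= t -> mass v (fun x => -1 * f x) x <= - C.
  move=> sx xt; rewrite (massZ v_L1 _ _ _ wf).
  - by rewrite mulN1r lerN2; exact: FC.
  - exact: lt_trans sx.
  - by apply: le_lt_trans tT; rewrite lee_fin.
have := tpairing_u_le wN FN; rewrite (tpairingZ s0 tT hu ww _ wf).
by rewrite mulN1r mulNr lerN2.
Qed.

Lemma tpairing_g_ge0 (f : X -> R) : (forall x, 0 <= f x) -> 0 <= tpairing T g f (win s t).
Proof.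
move=> f0; apply: Rintegral_ge0 => z _.
by rewrite mulr_ge0 ?powR_ge0// mulr_ge0// win_ge0.
Qed.

(** Integration of a pointwise inequality over the window. Two boxes appear on the right because the
    gradient of an annular cutoff lives at two scales. *)
Lemma combo_le r (f_ : 'I_N -> X -> R) (f : X -> R) C1 r1 C2 r2 :
  (forall i, weight (box r) (f_ i)) -> weight (box r) f ->
  0 <= r1 -> 0 <= r2 ->
  (forall z, \sum_i Du z ord0 i * f_ i z.1 + g z * f z.1 <=
     C1 * \1_(box r1) z.1 + C2 * \1_(box r2) z.1) ->
  \sum_i tpairing T (fun z => Du z ord0 i) (f_ i) (win s t) + tpairing T g f (win s t) <=
  (C1 * (2 * r1) ^+ N + C2 * (2 * r2) ^+ N) * (t - s).
Proof.
move=> wf_ wf r10 r20 H.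
have mC := @measurable_cylinder R N T.
pose k i (z : Z) := Du z ord0 i * (f_ i z.1 * win s t z.2).
have ik i : mu.-integrable (cylinder T) (EFin \o k i).
  exact: (tens_integrable s0 tT (Du_locint i) (wf_ i) ww).
have ig := tens_integrable s0 tT hg wf ww.
have i1 := tens_integrable s0 tT locint1 (box_weight r1) ww.
have i2 := tens_integrable s0 tT locint1 (box_weight r2) ww.
have isum (l : seq 'I_N) : mu.-integrable (cylinder T) (EFin \o (fun z => \sum_(i <- l) k i z)) /\
    \sum_(i <- l) tpairing T (fun z => Du z ord0 i) (f_ i) (win s t) =
    \int[mu]_(z in cylinder T) (\sum_(i <- l) k i z).
  elim: l => [|i l [IH1 IH2]].
    split; first by under eq_fun do rewrite big_nil; exact: integrable0.
    rewrite big_nil; under eq_Rintegral do rewrite big_nil.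
    by rewrite /Rintegral integral0.
  split.
    under eq_fun do rewrite big_cons.
    by have := integrableD mC (ik i) IH1; apply: eq_integrable.
  rewrite big_cons IH2 [RHS](@eq_Rintegral _ _ _ mu _ (fun z => k i z + \sum_(j <- l) k j z)).
    by rewrite RintegralD.
  by move=> z _; rewrite big_cons.
have [isk ->] := isum (index_enum 'I_N).
rewrite {1}/tpairing /pairing -RintegralD//.
rewrite mulrDl -!mulrA -!tpairing_one_box// /tpairing /pairing -!RintegralZl//.
have iZ1 : mu.-integrable (cylinder T) (EFin \o (fun z : Z => C1 * (1 * (\1_(box r1) z.1 * win s t z.2)))).
  by have := integrableZl mC C1 i1; apply: eq_integrable.
have iZ2 : mu.-integrable (cylinder T) (EFin \o (fun z : Z => C2 * (1 * (\1_(box r2) z.1 * win s t z.2)))).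
  by have := integrableZl mC C2 i2; apply: eq_integrable.
rewrite -RintegralD//.
apply: le_Rintegral => //.
- by have := integrableD mC isk ig; apply: eq_integrable.
- by have := integrableD mC iZ1 iZ2; apply: eq_integrable.
move=> z _; rewrite /k.
under eq_bigr do rewrite mulrA.
by rewrite -mulr_suml mulrA !mul1r !mulrA -!mulrDl ler_wpM2r ?win_ge0.
Qed.

End window.

End identities.

(** * Two inequalities on the reals *)

Section real_inequalities.
Variable R : realType.

(** For a <= 1 the term b suffices; there a^(q-1) may be far below a^(1/n), so the other terms could
    fail. For a > 1 the condition on q gives a <= (a^(q-1))^n, and b is compared with m a^(q-1) xi:
    if it is smaller the gradient term dominates, otherwise the last term does. *)
Lemma young_absorb (q a b m xi : R) n : 1 <= (q - 1) * n%:R -> 0 <= a -> 0 <= b ->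
  0 < m -> 0 <= xi <= 1 ->
  a * b * xi ^+ n <= b + m * (a `^ q * xi ^+ n.+1) + b ^+ n.+1 / m ^+ n.
Proof.
move=> qn a0 b0 m0 /andP[x0 x1].
have xn0 : 0 <= xi ^+ n by rewrite exprn_ge0.
have xn1 : xi ^+ n <= 1 by rewrite exprn_ile1.
have t1 : 0 <= m * (a `^ q * xi ^+ n.+1).
  by rewrite mulr_ge0 ?(ltW m0)// mulr_ge0 ?powR_ge0 ?exprn_ge0.
have t2 : 0 <= b ^+ n.+1 / m ^+ n by rewrite divr_ge0 ?exprn_ge0 ?(ltW m0).
have [a1|a1] := leP a 1.
  have : a * b * xi ^+ n <= b.
    rewrite mulrAC -[leRHS]mul1r ler_wpM2r// mulr_ile1//.
  by lra.
have ap : 0 < a by apply: lt_trans a1.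
set c := a `^ (q - 1).
have c0 : 0 <= c by exact: powR_ge0.
have qE : a `^ q = a * c.
  rewrite -{2}[a]powRr1// /c -powRD; last by rewrite (gt_eqF ap) implybT.
  by congr (_ `^ _); ring.
have cn : a <= c ^+ n.
  rewrite /c -powR_mulrn ?powR_ge0// -powRrM.
  by apply: le1r_powR => //; exact: ltW.
have [bm|bm] := leP b (m * c * xi).
  have H : a * b * xi ^+ n <= m * (a `^ q * xi ^+ n.+1).
    rewrite qE exprS; apply: (@le_trans _ _ (a * (m * c * xi) * xi ^+ n)).
      by rewrite ler_wpM2r// ler_wpM2l.
    by rewrite le_eqVlt; apply/orP; left; apply/eqP; ring.
  by lra.
have H : a * b * xi ^+ n <= b ^+ n.+1 / m ^+ n.
  rewrite ler_pdivlMr ?exprn_gt0// exprS.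
  have H1 : (m * c * xi) ^+ n <= b ^+ n.
    by rewrite lerXn2r ?nnegrE ?(ltW bm)// mulr_ge0// mulr_ge0// ltW.
  have H2 : m ^+ n * a * xi ^+ n <= b ^+ n.
    apply: le_trans H1; rewrite !exprMn ler_wpM2r// ler_wpM2l//.
    by rewrite exprn_ge0 ?ltW.
  apply: (@le_trans _ _ (b * (m ^+ n * a * xi ^+ n))); first by rewrite le_eqVlt; apply/orP; left; apply/eqP; ring.
  by rewrite ler_wpM2l.
by lra.
Qed.

Lemma bernoulli (x : R) k : 0 <= x -> 1 + x *+ k <= (1 + x) ^+ k.
Proof.
move=> x0; elim: k => [|k IH]; first by rewrite mulr0n addr0 expr0.
rewrite exprS; apply: (@le_trans _ _ ((1 + x) * (1 + x *+ k))).
  rewrite mulrSr -[x *+ k]mulr_natl; have : 0 <= x * (k%:R * x) by rewrite !mulr_ge0.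
  by lra.
by rewrite ler_wpM2l// addr_ge0.
Qed.

(* The inequality is a discrete form of -y' >= c y^(1+1/n) / s, whose solutions blow up
   at a positive time when followed backwards from a positive value. *)
Lemma backward_blowup (Y : R -> R) (n : nat) (s0 eta A : R) :
  (0 < n)%N -> 0 < eta -> 0 <= A ->
  (forall s s', 0 < s -> s <= s' -> s' <= s0 -> Y s' <= Y s) ->
  (forall s s' M, 0 < s -> s < s' -> s' <= s0 -> 0 < M ->
    (s' - s) * (Y s' - eta) <= 4 * M * s' * (Y s - Y s') + (s' - s) * (A / M ^+ n)) ->
  forall s, 0 < s -> s <= s0 -> Y s <= 2 * eta.
Proof.
move=> n0 eta0 A0 Ymono H s1 s1p s1s0; rewrite leNgt; apply/negP => Ys1.
pose Z s := Y s - eta.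
(* The error term takes at most half of [y]; the other half is the gain, whence 8 in place of 4. *)
have step_ s s' M y : 0 < s -> s < s' -> s' <= s0 -> 0 < M -> 0 < y -> y <= Z s' ->
    A / M ^+ n <= y / 2 -> y * (1 + (1 - s / s') / (8 * M)) <= Z s.
  move=> sp ss ss0 M0 y0 yZ AM.
  have s'p : 0 < s' by exact: lt_trans ss.
  have := H s s' M sp ss ss0 M0.
  rewrite -/(Z s') => H1.
  have H2 : (s' - s) * (A / M ^+ n) <= (s' - s) * (y / 2).
    by rewrite ler_wpM2l// subr_ge0 ltW.
  have H3 : (s' - s) * y <= (s' - s) * Z s' by rewrite ler_wpM2l// subr_ge0 ltW.
  have H4 : (s' - s) * (y / 2) <= 4 * M * s' * (Z s - y).
    apply: (@le_trans _ _ (4 * M * s' * (Z s - Z s'))).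
      have -> : Z s - Z s' = Y s - Y s' by rewrite /Z; ring.
      by lra.
    by rewrite ler_wpM2l ?lerD2l ?lerN2// !mulr_ge0// ltW.
  have -> : y * (1 + (1 - s / s') / (8 * M)) = y + (s' - s) * (y / 2) / (4 * M * s').
    by field; rewrite !gt_eqF.
  rewrite -lerBrDl ler_pdivrMr ?mulr_gt0//.
  by rewrite [leRHS]mulrC.
(* With [M] fixed, each halving of the time multiplies the lower bound for [Z] by 1 + 1/(16 M), so
   [Z] passes any level, although at times tending to 0. *)
have ph1 (V : R) : exists s, [/\ 0 < s, s <= s0 & V <= Z s].
  (* Large enough for the error to stay below [eta / 2]; this uses n >= 1. *)
  pose M := 1 + 2 * A / eta.
  have M1 : 1 <= M by rewrite lerDl divr_ge0 ?mulr_ge0 ?(ltW eta0).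
  have M0 : 0 < M by apply: lt_le_trans M1.
  have AM : A / M ^+ n <= eta / 2.
    rewrite ler_pdivrMr ?exprn_gt0//.
    apply: (@le_trans _ _ (eta / 2 * M)).
      by rewrite /M mulrDr mulr1 [X in _ + X](_ : _ = A) ?lerDr ?divr_ge0 ?(ltW eta0)//; field; rewrite gt_eqF.
    rewrite ler_wpM2l ?divr_ge0 ?(ltW eta0)//.
    by rewrite -{1}[M]expr1 ler_weXn2l.
  have gr k : eta * (1 + (16 * M)^-1) ^+ k <= Z (s1 / 2 ^+ k).
    elim: k => [|k IH].
      by rewrite !expr0 mulr1 divr1 /Z; lra.
    have p2 : 0 < s1 / 2 ^+ k by rewrite divr_gt0// exprn_gt0.
    have g1 : 1 <= (1 + (16 * M)^-1) ^+ k.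
      by rewrite exprn_ege1// lerDl invr_ge0 mulr_ge0// ltW.
    have e1 : eta <= eta * (1 + (16 * M)^-1) ^+ k by rewrite ler_peMr// ltW.
    have sE : s1 / 2 ^+ k.+1 = (s1 / 2 ^+ k) / 2.
      by rewrite exprSr invfM mulrA.
    have := step_ (s1 / 2 ^+ k.+1) (s1 / 2 ^+ k) M _ _ _ _ M0 _ IH _.
    rewrite sE => /(_ _); rewrite exprSr mulrA.
    have -> : 1 - s1 / 2 ^+ k / 2 / (s1 / 2 ^+ k) = 1 / 2.
      by rewrite mulrAC divff ?gt_eqF//; field.
    have -> : 1 / 2 / (8 * M) = (16 * M)^-1 by field; rewrite gt_eqF.
    apply.
    - by rewrite divr_gt0.
    - by rewrite ltr_pdivrMr// ltr_pMr//; lra.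
    - by apply: le_trans s1s0; rewrite ler_pdivrMr ?exprn_gt0// ler_peMr ?(ltW s1p)// exprn_ege1//; lra.
    - by apply: lt_le_trans e1.
    - by lra.
  have [k Vk] : exists k : nat, V <= eta * (1 + (16 * M)^-1) ^+ k.
    have [k Hk] : exists k : nat, V / eta * (16 * M) <= k%:R.
      by exists (Num.truncn (V / eta * (16 * M))).+1; apply/ltW; exact: truncnS_gt.
    exists k; rewrite mulrC -ler_pdivrMr//.
    apply: (@le_trans _ _ (1 + (16 * M)^-1 *+ k)).
      have e1 : V / eta <= k%:R / (16 * M) by rewrite ler_pdivlMr ?mulr_gt0.
      by rewrite -mulr_natl; lra.
    by apply: bernoulli; rewrite invr_ge0 mulr_ge0// ltW.
  exists (s1 / 2 ^+ k); split.
  - by rewrite divr_gt0// exprn_gt0.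
  - by apply: le_trans s1s0; rewrite ler_pdivrMr ?exprn_gt0// ler_peMr ?(ltW s1p)// exprn_ege1//; lra.
  - exact: le_trans Vk (gr k).
(* To reach every level before a fixed positive time, [M] is now halved at each move. The error
   [A / M ^+ n] then grows like D^j, and the lower bound y0 D^j keeps pace with it. *)
pose D : R := 2 ^+ n.
have D2 : 2 <= D by rewrite /D -{1}[2]expr1 ler_weXn2l//; lra.
have D0 : 0 < D by lra.
(* The relative move 1 - s_(j+1)/s_j is at least 2^-j / 4; divided by 8 M with M = mu 2^-j it is at
   least D. *)
pose mu := (32 * D)^-1.
have mu0 : 0 < mu by rewrite invr_gt0 mulr_gt0.
pose y0 := 1 + 2 * (A / mu ^+ n).
have Am0 : 0 <= A / mu ^+ n by rewrite divr_ge0// exprn_ge0// ltW.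
have y00 : 1 <= y0 by rewrite lerDl mulr_ge0.
have [s2 [s2p s2s0 Zs2]] := ph1 y0.
(* These times start at [s2] and decrease to [s2 / 2], where monotonicity makes [Y] dominate all the
   values met on the way. *)
pose sj (j : nat) := s2 * (2^-1 + 2^-1 ^+ j.+1).
have sjp j : 0 < sj j.
  by rewrite /sj mulr_gt0// addr_gt0 ?exprn_gt0 ?invr_gt0.
have grow j : y0 * D ^+ j <= Z (sj j).
  elim: j => [|j IH].
    by rewrite expr0 mulr1 /sj expr1 (_ : s2 * _ = s2)//; field.
  pose M := mu * 2^-1 ^+ j.
  have i0 : 0 < (2^-1 : R) ^+ j by rewrite exprn_gt0// invr_gt0.
  have i1 : (2^-1 : R) ^+ j <= 1 by rewrite exprn_ile1// ?invr_ge0//; lra.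
  have M0 : 0 < M by rewrite mulr_gt0.
  have yj : 0 < y0 * D ^+ j by rewrite mulr_gt0 ?exprn_gt0//; lra.
  have ss : sj j.+1 < sj j.
    by rewrite /sj ltr_pM2l// ltrD2l [X in X < _]exprS; rewrite gtr_pMl ?exprS ?mulr_gt0 ?invr_gt0//; lra.
  have sle : sj j <= s0.
    apply: le_trans s2s0; rewrite /sj ger_pMr// exprS; lra.
  have AM : A / M ^+ n <= y0 * D ^+ j / 2.
    have -> : A / M ^+ n = A / mu ^+ n * D ^+ j.
      rewrite /M /D exprMn invfM mulrA; congr (_ * _).
      by rewrite !exprVn invrK -!exprM mulnC.
    rewrite [leRHS]mulrAC ler_wpM2r ?exprn_ge0 ?(ltW D0)// /y0; lra.
  apply: le_trans (step_ _ _ M _ (sjp _) ss sle M0 yj IH AM).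
  rewrite exprSr mulrA ler_wpM2l ?(ltW yj)//.
  have h1 : 2^-1 ^+ j / 4 <= 1 - sj j.+1 / sj j.
    rewrite lerBrDr -lerBrDl ler_pdivrMr// /sj !exprS.
    have : 0 <= s2 * 2^-1 ^+ j * (1 - 2^-1 ^+ j).
      by rewrite mulr_ge0 ?subr_ge0// mulr_ge0// ltW.
    by lra.
  have h2 : D * (8 * M) <= 2^-1 ^+ j / 4.
    have E (d e : R) : 0 < d -> d * (8 * ((32 * d)^-1 * e)) = e / 4.
      by move=> d0; field; rewrite gt_eqF.
    by rewrite /M /mu E.
  have : D <= (1 - sj j.+1 / sj j) / (8 * M).
    rewrite ler_pdivlMr ?mulr_gt0//; exact: le_trans h1.
  lra.
have : forall j : nat, j%:R <= Z (s2 / 2).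
  move=> j; apply: (@le_trans _ _ (Z (sj j))).
    apply: le_trans (grow j); apply: (@le_trans _ _ (D ^+ j)); last by rewrite ler_peMl ?exprn_ge0 ?(ltW D0).
    apply: (@le_trans _ _ (2 ^+ j)); last by rewrite lerXn2r ?nnegrE ?(ltW D0)//.
    by rewrite -natrX ler_nat ltnW// ltn_expl.
  rewrite /Z lerD2r; apply: Ymono.
  - by rewrite divr_gt0.
  - by rewrite /sj ler_pM2l// lerDl exprn_ge0// invr_ge0.
  - apply: le_trans s2s0; rewrite /sj ger_pMr// exprS.
    have : (2^-1 : R) ^+ j <= 1 by rewrite exprn_ile1 ?invr_ge0//; lra.
    by lra.
move=> /(_ (Num.truncn (Z (s2 / 2))).+1); rewrite leNgt.
by rewrite truncnS_gt.
Qed.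

End real_inequalities.

(** * Positivity of the representative *)

Section positivity.
Variables (R : realType) (N : nat) (T : \bar R).
Local Notation X := 'rV[R]_N.
Local Notation mux := (lebesgue_rV R N).
Local Notation mut := (@lebesgue_measure R).
Local Notation mu := (lebesgue_spacetime R N).
Local Notation Z := (X * measurableTypeR R)%type.

(** A ball has positive length and does not fit into a null set. *)
Lemma ae_nbhs_ex (Q U : set R) (t : R) : {ae mut, forall x, Q x} -> nbhs t U ->
  exists2 x, U x & Q x.
Proof.
move=> [A [mA A0 QA]] /nbhs_ballP[e /= e0 tU]; apply: contrapT => H.
have sub : ball t e `<=` A.
  by move=> x /tU Ux; apply: QA => /= Qx; apply: H; exists x.
have : (mut (ball t e) <= mut A)%E.
  by apply: le_measure => //; rewrite inE//; exact: measurable_ball.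
rewrite A0 lebesgue_measure_ball ?(ltW e0)// => ee.
have : e *+ 2 <= 0 by rewrite -lee_fin.
by rewrite mulr2n leNgt addr_gt0.
Qed.

Lemma near_time (t : R) : 0 < t -> (t%:E < T)%E ->
  \forall x \near t, 0 < x /\ (x%:E < T)%E.
Proof.
move=> t0 tT; have nT : \forall x \near t, (x%:E < T)%E.
  case: T tT => [T' tT|_|//].
    near=> x; rewrite lte_fin; near: x; apply: lt_nbhsl; by rewrite -lte_fin.
  by near=> x; rewrite ltry.
by near=> x; split; near: x; [exact: lt_nbhsr|].
Unshelve. all: by end_near.
Qed.

Variables (u : X * R -> R) (v : R -> X -> R).
Hypothesis u_ge0 : {ae mu, forall z, cylinder T z -> 0 <= u z}.
Hypothesis hv : continuous_representative T u v.

Let v_L1 : forall t : R, 0 < t -> (t%:E < T)%E -> L1_loc_space (v t).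
Proof. by case: hv. Qed.

Let v_cont : forall s : R, 0 < s -> (s%:E < T)%E ->
  forall K : set X, compact K ->
    (\int[mux]_(x in K) `|v t x - v s x|) @[t --> s] --> 0.
Proof. by case: hv. Qed.

Lemma v_ae_ge0 : {ae mut, forall t, 0 < t -> (t%:E < T)%E ->
  {ae mux, forall x, 0 <= v t x}}.
Proof.
have [vu _ _] := hv.
have h1 := ae_slices vu; have h2 := ae_slices u_ge0.
apply: filterS2 h1 h2 => t a1 a2 t0 tT.
by apply: filterS2 a1 a2 => x b1 b2; rewrite (b1 (conj t0 tT)) b2.
Qed.

(** The sign of the slice is known at almost every time only. A negative mass at [t] would persist
    nearby by continuity, and would meet a time where the slice is nonnegative. *)
Lemma mass_ge0 t r (f : X -> R) : 0 < t -> (t%:E < T)%E -> weight (box r) f ->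
  (forall x, 0 <= f x) -> 0 <= mass v f t.
Proof.
move=> t0 tT wf f0; rewrite leNgt; apply/negP => Ft.
have cF := mass_continuous v_L1 v_cont t0 tT wf.
have nF : \forall x \near t, mass v f x < 0.
  by have := cF [set y | y < 0]; apply; exact: lt_nbhsl.
have [x [Fx [x0 xT]] vx] := ae_nbhs_ex v_ae_ge0 (filterI nF (near_time t0 tT)).
have {}vx := vx x0 xT.
suff : 0 <= mass v f x by rewrite leNgt Fx.
have ivf := mass_integrable v_L1 x0 xT wf.
have [mf _ _] := wf; have [mv _] := v_L1 x0 xT.
rewrite /mass /Rintegral (_ : (\int[mux]_x0 _)%E = (\int[mux]_y (`|v x y| * f y)%:E)%E).
  by apply: fine_ge0; apply: integral_ge0 => y _; rewrite lee_fin mulr_ge0.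
apply: ae_eq_integral => //.
- exact: (measurable_int mux ivf).
- apply/measurable_EFinP; apply: measurable_funM => //.
  by apply: measurableT_comp.
- by apply: filterS vx => y vy _; rewrite ger0_norm.
Qed.

Lemma mass_le t r (f1 f2 : X -> R) : 0 < t -> (t%:E < T)%E ->
  weight (box r) f1 -> weight (box r) f2 -> (forall x, f1 x <= f2 x) ->
  mass v f1 t <= mass v f2 t.
Proof.
move=> t0 tT w1 w2 f12.
have wN : weight (box r) (fun x => -1 * f1 x).
  by apply: (@weightM _ _ _ (box r) (fun=> -1)) w1 => //; exists 1 => x; rewrite normrN1.
have wD := weightD w2 wN.
have := mass_ge0 t0 tT wD.
rewrite (massD v_L1 t0 tT w2 wN) (massZ v_L1 _ t0 tT w1) mulN1r subr_ge0; apply.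
by move=> x; rewrite mulN1r subr_ge0.
Qed.

Lemma v_ae_eq0_box t r (f : X -> R) : 0 < t -> (t%:E < T)%E ->
  weight (box r) f -> (forall x, 0 <= f x) ->
  {ae mux, forall x, 0 <= v t x} -> mass v f t = 0 ->
  {ae mux, forall x, 0 < f x -> v t x = 0}.
Proof.
move=> t0 tT wf f0 vt F0.
have ivf := mass_integrable v_L1 t0 tT wf.
have mvf := measurable_int mux ivf.
have [mf _ _] := wf; have [mv _] := v_L1 t0 tT.
have E : (\int[mux]_y `|(v t y * f y)%:E| = 0)%E.
  transitivity ((mass v f t)%:E); last by rewrite F0.
  rewrite /mass /Rintegral fineK; last by apply: integrable_fin_num.
  apply: ae_eq_integral => //.
  - exact: measurableT_comp.
  - by apply: filterS vt => y vy _; rewrite gee0_abs// lee_fin mulr_ge0.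
have /(ae_eq_integral_abs mux measurableT mvf) := E.
apply: filterS => x /(_ Logic.I) /= /eqP; rewrite eqe mulf_eq0 => /orP[/eqP//|/eqP ->].
by rewrite ltxx.
Qed.

(** A zero mass at [t] alone proves nothing, since [v t] has no known sign there. At nearby times of
    known sign the slice vanishes on the box, and L^1 continuity carries this to [t]. *)
Lemma v_ae_eq0 (zeta : nat -> X -> R) (r : nat -> R) :
  (forall k, weight (box (r k)) (zeta k)) -> (forall k x, 0 <= zeta k x) ->
  (forall k x, box k.+1%:R x -> 0 < zeta k x) ->
  (forall k t, 0 < t -> (t%:E < T)%E -> mass v (zeta k) t = 0) ->
  forall t, 0 < t -> (t%:E < T)%E -> {ae mux, forall x, v t x = 0}.
Proof.
move=> wz z0 zp Fz t t0 tT.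
have [mv _] := v_L1 t0 tT.
have zero k : {ae mux, forall x, box k.+1%:R x -> v t x = 0}.
  set K : set X := box k.+1%:R.
  have mK : measurable K by exact: measurable_box.
  have iK : mux.-integrable K (EFin \o v t) by exact: (v_box_integrable v_L1 _ t0 tT).
  suff I0 : \int[mux]_(x in K) `|v t x| = 0.
    have E : (\int[mux]_(x in K) `|(v t x)%:E| = 0)%E.
      have iN := integrable_norm iK.
      transitivity ((\int[mux]_(x in K) `|v t x|)%:E); last by rewrite I0.
      by rewrite /Rintegral fineK//; apply: integrable_fin_num.
    have := ae_eq_integral_abs mux mK (measurable_int mux iK) => -[/(_ E) H _].
    by apply: filterS H => x H1 /H1 /= [].
  apply/eqP; rewrite eq_le; apply/andP; split; last first.
    by apply: Rintegral_ge0.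
  apply/ler_addgt0Pr => e e0; rewrite add0r.
  have /cvgrPdist_le /(_ _ e0) H := v_cont t0 tT (@box_compact R N k.+1%:R).
  have [x [Hx [x0 xT]] vx] := ae_nbhs_ex v_ae_ge0 (filterI H (near_time t0 tT)).
  have vx0 := v_ae_eq0_box x0 xT (wz k) (z0 k) (vx x0 xT) (Fz k x x0 xT).
  have [mvx _] := v_L1 x0 xT.
  have E : \int[mux]_(y in K) `|v x y - v t y| = \int[mux]_(y in K) `|v t y|.
    rewrite /Rintegral; congr fine; apply: ae_eq_integral => //.
    - apply/measurable_EFinP; apply: measurable_funTS; apply: measurableT_comp => //.
      exact: measurable_funB.
    - apply/measurable_EFinP; apply: measurable_funTS; exact: measurableT_comp.
    - by apply: filterS vx0 => y vy Ky; rewrite vy ?zp// sub0r normrN.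
  by move: Hx => /=; rewrite sub0r normrN E; exact: le_trans (ler_norm _).
have /ae_foralln := zero.
apply: filterS => x xk; apply: (xk (Num.truncn (\sum_i `|x ord0 i|))) => i.
apply/ltW; apply: (le_lt_trans _ (truncnS_gt _)).
by rewrite (bigD1 i)//= lerDl sumr_ge0.
Qed.

End positivity.

(** * Removability of the origin and decay *)

(** The two terms of [young_absorb] that do not contain [a], for m = 1/2. *)
Definition young_cost (R : realType) (n : nat) (b : R) := b + 2 ^+ n * b ^+ n.+1.

Section core.
Variables (R : realType) (N : nat) (T : \bar R) (q : R).
Local Notation X := 'rV[R]_N.
Local Notation mux := (lebesgue_rV R N).
Local Notation mu := (lebesgue_spacetime R N).
Local Notation seg a b := (`[a, b]%classic : set (measurableTypeR R)).
Variables (u : X * R -> R) (Du : X * R -> X) (v : R -> X -> R).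
Hypothesis hN : (1 <= N)%N.
Local Notation n := N.+1.
Hypothesis hq : 1 <= (q - 1) * n%:R.
Hypothesis hu : locint T u.
Hypothesis u_ge0 : {ae mu, forall z, cylinder T z -> 0 <= u z}.
Hypothesis hDu : is_weak_gradient T u Du.
Let g z := euclidean_norm (Du z) `^ q.
Hypothesis hg : locint T g.
Hypothesis hHJ : viscous_HJ T q u Du.
Hypothesis hv : continuous_representative T u v.
Hypothesis hlim : forall phi : X -> R, Cc (~` [set (0 : X)]) phi ->
  (\int[mux]_(x in [set: X]) (v t x * phi x)) @[t --> 0^'+] --> 0.

Let v_L1 : forall t : R, 0 < t -> (t%:E < T)%E -> L1_loc_space (v t).
Proof. by case: hv. Qed.

Local Notation tgrad i := (tpairing T (fun z => Du z ord0 i)).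
Local Notation mv := (mass v).
Local Notation h := (@young_cost R n).
Local Notation cut xi := (fun x => xi x ^+ n.+1).

Let mass_lim (f : X -> R) : Cc (~` [set (0 : X)]) f -> mv f s @[s --> 0^'+] --> 0.
Proof. exact: hlim. Qed.

Lemma abs_coord_le z i : `|Du z ord0 i| <= euclidean_norm (Du z).
Proof.
rewrite /euclidean_norm -sqrtr_sqr ler_wsqrtr// (bigD1 i)//= lerDl.
by apply: sumr_ge0 => j _; exact: sqr_ge0.
Qed.

Lemma euclidean_norm_ge0 z : 0 <= euclidean_norm (Du z).
Proof. exact: sqrtr_ge0. Qed.

(** The gradient of [xi ^+ n.+1] carries [xi ^+ n], the power that [young_absorb] bounds by the
    gradient term weighted with [xi ^+ n.+1]. The weight m = 1/2 leaves half of that term on the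
    left. *)
Lemma absorbed_energy s t r (xi : X -> R) C1 r1 C2 r2 :
  0 < s -> s <= t -> (t%:E < T)%E -> 0 <= r -> stest r xi ->
  (forall x, 0 <= xi x <= 1) -> 0 <= r1 -> 0 <= r2 ->
  (forall x, let b := n.+1%:R * \sum_i `|'D_(dir R i) xi x| in
     b + 2 ^+ n * b ^+ n.+1 <= C1 * \1_(box r1) x + C2 * \1_(box r2) x) ->
  mv (cut xi) t - mv (cut xi) s + 2^-1 * tpairing T g (cut xi) (win s t) <=
  (C1 * (2 * r1) ^+ N + C2 * (2 * r2) ^+ N) * (t - s).
Proof.
move=> s0 st tT r0 txi xi01 r10 r20 Hb.
have tz : stest r (cut xi) := stestX n txi.
have exi := stest_elem txi.
rewrite (energy_grad hu hDu hg hHJ hv s0 st tT r0 tz).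
have ww : weight (seg s t) (win s t : measurableTypeR R -> R) by exact: win_weight.
have wDz i := stest_weight r0 (stest_derive (dir R i) tz).
have wz := stest_weight r0 tz.
have wN i := stest_weight r0 (stestZ (-1) (stest_derive (dir R i) tz)).
have wN2 := stest_weight r0 (stestZ (- 2^-1) tz).
have := combo_le hDu hg s0 st tT (f_ := fun i x => -1 * 'D_(dir R i) (cut xi) x)
   (f := fun x => - 2^-1 * cut xi x) (r := r) (C1 := C1) (r1 := r1) (C2 := C2) (r2 := r2) wN wN2 r10 r20.
rewrite (tpairingZ s0 tT hg ww _ wz).
under eq_bigr do rewrite (tpairingZ s0 tT (Du_locint hDu _) ww _ (wDz _)) mulN1r.
rewrite sumrN => H.
suff H' : - (\sum_i tgrad i ('D_(dir R i) (cut xi)) (win s t)) - 2^-1 * tpairing T g (cut xi) (win s t) <=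
   (C1 * (2 * r1) ^+ N + C2 * (2 * r2) ^+ N) * (t - s) by rewrite -/g; lra.
rewrite -mulNr; apply: H => z.
have := Hb z.1; cbv zeta; set b := n.+1%:R * _ => Hbz.
apply: le_trans Hbz.
have b0 : 0 <= b by rewrite mulr_ge0// sumr_ge0.
have := @young_absorb R q (euclidean_norm (Du z)) b 2^-1 (xi z.1) n hq (euclidean_norm_ge0 z) b0 _ (xi01 z.1).
rewrite exprVn invrK => /(_ _) Y.
have {}Y := Y (ltac:(by rewrite invr_gt0)).
have S : \sum_i Du z ord0 i * (-1 * 'D_(dir R i) (cut xi) z.1) <=
    euclidean_norm (Du z) * b * xi z.1 ^+ n.
  have [x0 x1] := andP (xi01 z.1).
  rewrite /b mulr_sumr mulr_sumr mulr_suml; apply: ler_sum => i _.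
  rewrite (elem_deriveX n (dir R i) z.1 exi).
  apply: le_trans (ler_norm _) _.
  rewrite !normrM normrN1 mul1r (ger0_norm (exprn_ge0 _ x0)) normr_nat.
  apply: (@le_trans _ _ (euclidean_norm (Du z) * (n.+1%:R * xi z.1 ^+ n * `|'D_(dir R i) xi z.1|))).
    by rewrite ler_wpM2r ?abs_coord_le// !mulr_ge0// exprn_ge0.
  by rewrite le_eqVlt; apply/orP; left; apply/eqP; ring.
rewrite /g; lra.
Qed.

Variable M : R.
Hypothesis M0 : 0 <= M.
Hypothesis derive_bumpr_le : forall (r : R) (i : 'I_N) (x : X), 0 < r ->
  `|'D_(dir R i) (bumpr r) x| <= M / r.

(* Constants are section variables with defining equations rather than local
   definitions: the latter are unfolded at great cost when closing trivial goals. *)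
Variables b1 C : R.
Hypothesis b1E : b1 = n.+1%:R * (N%:R * M).
Hypothesis CE : C = 2 * b1 + 2 ^+ n * (2 * b1) ^+ n.+1.

Let b10 : 0 <= b1.
Proof. by rewrite b1E mulr_ge0// mulr_ge0. Qed.

Let C0 : 0 <= C.
Proof.
rewrite CE; apply: addr_ge0; first exact: mulr_ge0.
by apply: mulr_ge0; apply: exprn_ge0 => //; exact: mulr_ge0.
Qed.

Lemma grad_bumpr_le rho (x : X) : 0 < rho ->
  \sum_i `|'D_(dir R i) (bumpr rho) x| <= N%:R * M / rho * \1_(box (2 * rho)) x.
Proof.
move=> rho0; rewrite indicE; have [xr|xr] := pselect (box (2 * rho) x); last first.
  rewrite memNset// mulr0 big1// => i _.
  by rewrite (derive_bumpr_out i rho0 xr) normr0.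
rewrite mem_set// mulr1; apply: (@le_trans _ _ (\sum_(i < N) M / rho)).
  by apply: ler_sum => i _; exact: derive_bumpr_le.
by rewrite sumr_const card_ord -[leLHS]mulr_natl mulrA.
Qed.


Let h_mono b c : 0 <= b -> b <= c -> h b <= h c.
Proof.
move=> b0 bc; rewrite /young_cost lerD// ler_wpM2l ?exprn_ge0//.
by rewrite lerXn2r ?nnegrE//; exact: le_trans bc.
Qed.

Let h_C b : 0 <= b -> b <= 2 * b1 -> h b <= C.
Proof. by move=> b0 /(h_mono b0); rewrite CE. Qed.

(** For e <= 1 the top power dominates the linear term. [C] is the cost of [2 * b1], the factor 2
    making room for the gradients of two cutoffs at once. *)
Let h_scale e b : 0 < e -> e <= 1 -> 0 <= b -> b <= 2 * b1 / e -> h b <= C / e ^+ n.+1.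
Proof.
move=> e0 e1 b0 be; apply: le_trans (h_mono b0 be) _.
have -> : C / e ^+ n.+1 = 2 * b1 / e ^+ n.+1 + 2 ^+ n * (2 * b1) ^+ n.+1 / e ^+ n.+1.
  by rewrite CE mulrDl.
rewrite /young_cost; apply: lerD.
  rewrite ler_wpM2l ?mulr_ge0// lef_pV2 ?posrE ?exprn_gt0//.
  by rewrite exprS ler_piMr ?(ltW e0)// exprn_ile1 ?(ltW e0).
by rewrite expr_div_n mulrA.
Qed.

Lemma bumpr01 r (x : X) : 0 <= bumpr r x <= 1.
Proof. by rewrite bumpr_ge0 bumpr_le1. Qed.

Lemma absorbed_bumpr s t rho : 0 < s -> s <= t -> (t%:E < T)%E -> 1 <= rho ->
  mv (cut (bumpr rho)) t - mv (cut (bumpr rho)) s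
    + 2^-1 * tpairing T g (cut (bumpr rho)) (win s t) <= C * (4 * rho) ^+ N * (t - s).
Proof.
move=> s0 st tT r1; have r0 : 0 < rho by apply: lt_le_trans r1.
have r20 : 0 <= 2 * rho by rewrite mulr_ge0// ltW.
have := @absorbed_energy s t (2 * rho) (bumpr rho) C (2 * rho) 0 0 s0 st tT r20
  (stest_bumpr N r0) (@bumpr01 rho) r20 (lexx _).
rewrite mul0r addr0 mulrA (_ : 2 * 2 = 4); last by rewrite -natrM.
apply => x; cbv zeta; rewrite mul0r addr0.
set b := n.+1%:R * _; have b0 : 0 <= b by rewrite mulr_ge0// sumr_ge0.
have : b <= b1 / rho * \1_(box (2 * rho)) x.
  rewrite /b b1E -!mulrA ler_wpM2l//.
  by have := grad_bumpr_le x r0; rewrite !mulrA.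
rewrite -/(h b) indicE; case: (_ \in _); rewrite ?mulr1 ?mulr0 => bb.
  apply: h_C => //; apply: le_trans bb _; rewrite ler_pdivrMr//.
  apply: (@le_trans _ _ (2 * b1)); last by rewrite ler_peMr// mulr_ge0.
  by rewrite ler_peMl//; lra.
have -> : b = 0 by apply/le_anti; rewrite bb.
by rewrite /young_cost expr0n mulr0 addr0.
Qed.

(** * Mass away from the origin *)

Definition annulus rho e (x : X) := bumpr rho x * (1 - bumpr e x).

Lemma stest_annulus rho e : 0 < rho -> stest (2 * rho) (annulus rho e).
Proof.
move=> r0; have [er rx] := stest_bumpr N r0; split.
  by apply: elemM => //; apply: elemB; [exact: elem_cst|exact: elem_bumpr].
by move=> x /rx; rewrite /annulus => ->; rewrite mul0r.
Qed.

Lemma annulus01 rho e (x : X) : 0 <= annulus rho e x <= 1.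
Proof.
have /andP[a0 a1] := bumpr01 rho x; have /andP[c0 c1] := bumpr01 e x.
rewrite /annulus; apply/andP; split; first by apply: mulr_ge0; lra.
by apply: mulr_ile1; lra.
Qed.

Lemma grad_annulus_le rho e (x : X) : 0 < rho -> 0 < e ->
  \sum_i `|'D_(dir R i) (annulus rho e) x| <=
  N%:R * M / e * \1_(box (2 * e)) x + N%:R * M / rho * \1_(box (2 * rho)) x.
Proof.
move=> r0 e0; apply: le_trans (lerD (grad_bumpr_le x e0) (grad_bumpr_le x r0)).
rewrite -big_split; apply: ler_sum => i _ /=.
have e1 : elem (fun x : X => 1 + -1 * bumpr e x).
  by apply: elemD; [exact: elem_cst|apply: elemZ; exact: elem_bumpr].
rewrite (_ : annulus rho e = fun x => bumpr rho x * (1 + -1 * bumpr e x)); last first.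
  by apply/funext => y; rewrite mulN1r.
rewrite (elem_deriveM _ _ (@elem_bumpr R N rho) e1).
rewrite elem_deriveD; [|exact: elem_cst|apply: elemZ; exact: elem_bumpr].
rewrite derive_cst add0r elem_deriveZ; last exact: elem_bumpr.
have /andP[a0 a1] := bumpr01 rho x; have /andP[c0 c1] := bumpr01 e x.
apply: le_trans (ler_normD _ _) _; rewrite !normrM normrN1 mul1r lerD//.
  by rewrite ler_piMl// ger0_norm.
by rewrite ler_piMl// ger0_norm; lra.
Qed.

Lemma limit_bound (G : R -> R) t y K : G s @[s --> 0^'+] --> 0 -> 0 < t -> 0 <= K ->
  (forall s, 0 < s -> s <= t -> y <= G s + K * (t - s)) -> y <= K * t.
Proof.
move=> G0 t0 K0 H; apply/ler_addgt0Pr => e e0.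
have /cvgrPdist_le /(_ _ e0) nG := G0.
have [s [Gs [s0 st]]] : exists s, `|0 - G s| <= e /\ 0 < s /\ s <= t.
  have : \forall s \near 0^'+, `|0 - G s| <= e /\ 0 < s /\ s <= t.
    near=> s; split; first by near: s.
    by split; near: s; [exact: nbhs_right_gt|exact: nbhs_right_le].
  by move=> Hn; have [s Hs] := @filter_ex _ (0^'+) _ _ Hn; exists s.
apply: le_trans (H s s0 st) _.
rewrite sub0r normrN in Gs; have := le_trans (ler_norm _) Gs.
have : 0 <= K * s by rewrite mulr_ge0// ltW.
by lra.
Unshelve. all: by end_near.
Qed.

Definition outer_const (rho : R) : R := C * 4 ^+ N * (rho ^+ N + 1).
Local Notation Kout := outer_const.

(** The inner gradient costs e^-(N+2) on a box of volume of order e^N, which leaves e^-2; the outer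
    one costs a multiple of rho^N. The cutoff vanishes near the origin, so the initial condition
    applies as s -> 0. *)
Lemma outer_mass rho e t : 1 <= rho -> 0 < e -> e <= 1 -> 0 < t -> (t%:E < T)%E ->
  mv (cut (annulus rho e)) t <= Kout rho / e ^+ 2 * t.
Proof.
move=> r1 e0 e1 t0 tT; have r0 : 0 < rho by apply: lt_le_trans r1.
have r20 : 0 <= 2 * rho by rewrite mulr_ge0// ltW.
have e20 : 0 <= 2 * e by rewrite mulr_ge0// ltW.
have ta := stest_annulus e r0.
have K0 : 0 <= Kout rho / e ^+ 2.
  by rewrite divr_ge0 ?exprn_ge0 ?(ltW e0)// mulr_ge0 ?addr_ge0 ?exprn_ge0 ?(ltW r0)// mulr_ge0 ?exprn_ge0.
apply: (limit_bound _ t0 K0) => [|s s0 st].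
  apply: mass_lim; apply: (stest_Cc (stestX n ta)) => x /contrapT ->.
  near=> y; rewrite /annulus (bumpr_in (x := y) e0) ?subrr ?mulr0 ?expr0n//.
  by near: y; apply: near_inside_box => i; rewrite mxE normr0.
have := @absorbed_energy s t (2 * rho) (annulus rho e) C (2 * rho) (C / e ^+ n.+1) (2 * e) s0 st tT r20
  ta (@annulus01 rho e) r20 e20.
have g0 : 0 <= tpairing T g (cut (annulus rho e)) (win s t).
  by apply: tpairing_g_ge0 => x; rewrite exprn_ge0//; case/andP: (annulus01 rho e x).
move=> /(_ _) H.
suff : mv (cut (annulus rho e)) t - mv (cut (annulus rho e)) s <= Kout rho / e ^+ 2 * (t - s).
  lra.
apply: (@le_trans _ _ ((C * (2 * (2 * rho)) ^+ N + C / e ^+ n.+1 * (2 * (2 * e)) ^+ N) * (t - s))).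
  apply: le_trans (H _); first by rewrite lerDl mulr_ge0 ?invr_ge0.
  move=> x; cbv zeta.
  set b := n.+1%:R * _; have b0 : 0 <= b by rewrite mulr_ge0// sumr_ge0.
  have : b <= b1 / e * \1_(box (2 * e)) x + b1 / rho * \1_(box (2 * rho)) x.
    rewrite /b b1E -!mulrA -mulrDr ler_wpM2l//.
    by have := grad_annulus_le x r0 e0; rewrite !mulrA.
  have ir : b1 / rho <= b1 by rewrite ler_pdivrMr// ler_peMr.
  have ie : b1 <= b1 / e by rewrite ler_pdivlMr// ler_piMr.
  rewrite -/(h b) [\1_(box (2 * e)) x]indicE; case: (_ \in _); rewrite ?mulr1 ?mulr0 ?addr0 ?add0r => bb.
    apply: (@le_trans _ _ (C / e ^+ n.+1)); last by rewrite lerDr mulr_ge0// indicE.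
    apply: h_scale => //; apply: le_trans bb _.
    apply: (@le_trans _ _ (b1 / e + b1 / rho)); last by rewrite -mulrA; lra.
    by rewrite lerD2l indicE; case: (_ \in _); rewrite ?mulr1 ?mulr0 ?divr_ge0 ?(ltW r0).
  move: bb; rewrite indicE; case: (_ \in _); rewrite ?mulr1 ?mulr0 => bb.
    by apply: h_C => //; lra.
  have -> : b = 0 by apply/le_anti; rewrite bb.
  by rewrite /young_cost expr0n mulr0 addr0.
rewrite ler_wpM2r ?subr_ge0//.
have -> : C / e ^+ n.+1 * (2 * (2 * e)) ^+ N = C * 4 ^+ N / e ^+ 2.
  rewrite mulrA (_ : 2 * 2 = 4) -?natrM// exprMn -[n.+1]addn2 exprD.
  have E (x y k : R) : x != 0 -> y != 0 -> C / (x * y) * (k * x) = C * k / y.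
    by move=> x0 y0; field; rewrite x0 y0.
  by rewrite E ?expf_neq0 ?gt_eqF.
rewrite mulrA (_ : 2 * 2 = 4) -?natrM// exprMn /outer_const.
have e21 : 1 <= (e ^+ 2)^-1 by rewrite invf_ge1 ?exprn_gt0// exprn_ile1// ltW.
have -> : C * 4 ^+ N * (rho ^+ N + 1) / e ^+ 2 =
   C * 4 ^+ N * rho ^+ N / e ^+ 2 + C * 4 ^+ N / e ^+ 2 by ring.
rewrite lerD2r mulrA ler_peMr// !mulr_ge0 ?exprn_ge0 ?(ltW r0)//.
Unshelve. all: by end_near.
Qed.

Definition slope_const (rho : R) : R := C * (4 * rho) ^+ N.
Local Notation C1 := slope_const.

Let C1_ge0 rho : 1 <= rho -> 0 <= C1 rho.
Proof. by move=> r1; rewrite /slope_const mulr_ge0// exprn_ge0// mulr_ge0//; lra. Qed.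

Lemma bumpr_almost_decr rho s t : 1 <= rho -> 0 < s -> s <= t -> (t%:E < T)%E ->
  mv (cut (bumpr rho)) t <= mv (cut (bumpr rho)) s + C1 rho * (t - s).
Proof.
move=> r1 s0 st tT; have := absorbed_bumpr s0 st tT r1.
have : 0 <= tpairing T g (cut (bumpr rho)) (win s t).
  by apply: tpairing_g_ge0 => x; rewrite exprn_ge0// bumpr_ge0.
rewrite -/(C1 rho); lra.
Qed.

(** * Mass near the origin *)

Definition div_bump e (x : X) :=
  \sum_i 'D_(dir R i) (fun y : X => y ord0 i * bumpr e y) x.

Lemma div_bumpE e x :
  div_bump e x = N%:R * bumpr e x + \sum_i x ord0 i * 'D_(dir R i) (bumpr e) x.
Proof.
rewrite /div_bump.
rewrite (eq_bigr (fun i => bumpr e x + x ord0 i * 'D_(dir R i) (bumpr e) x)).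
  by rewrite big_split /= sumr_const card_ord mulr_natl.
move=> i _; rewrite elem_deriveM; [|exact: elem_coord|exact: elem_bumpr].
by rewrite derive_coord eqxx mulr1 addrC.
Qed.

(** [div_bump e] is the divergence of x cut off at size e, so it is N near the origin; the annular
    terms repair it elsewhere. *)
Lemma div_bump_ge rho e (x : X) : 1 <= rho -> 0 < e -> 2 * e <= 1 ->
  N%:R / 2 * bumpr rho x ^+ n.+1 <= div_bump e x +
    (2 * N%:R * M * annulus rho (e / 4) x ^+ n.+1
     + N%:R / 2 * 2 ^+ n.+1 * annulus rho e x ^+ n.+1).
Proof.
move=> r1 e0 e1; have r0 : 0 < rho by apply: lt_le_trans r1.
have /andP[z0 z1] := bumpr01 rho x; have /andP[c0 c1] := bumpr01 e x.
have zn0 : 0 <= bumpr rho x ^+ n.+1 by rewrite exprn_ge0.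
have zn1 : bumpr rho x ^+ n.+1 <= 1 by rewrite exprn_ile1.
have an0 d : 0 <= annulus rho d x ^+ n.+1.
  by rewrite exprn_ge0//; case/andP: (annulus01 rho d x).
(* Where [bumpr e] is below 1/2, [annulus rho e] exceeds half of [bumpr rho]: this is the factor
   [2 ^+ n.+1]. *)
have p1 : bumpr rho x ^+ n.+1 <= 2 * bumpr e x + 2 ^+ n.+1 * annulus rho e x ^+ n.+1.
  have [be|be] := leP 2^-1 (bumpr e x).
    have := an0 e; have : 0 <= (2 : R) ^+ n.+1 by rewrite exprn_ge0.
    by move=> t1 t2; have := mulr_ge0 t1 t2; lra.
  suff : bumpr rho x ^+ n.+1 <= 2 ^+ n.+1 * annulus rho e x ^+ n.+1 by lra.
  have d1 : 1 <= (2 * (1 - bumpr e x)) ^+ n.+1 by apply: exprn_ege1; lra.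
  rewrite /annulus exprMn mulrCA -exprMn.
  by rewrite -{1}[_ ^+ _]mulr1 ler_wpM2l.
(* The sum is nonzero only between sizes e and 2e, where |x_i| <= 2e against a derivative at most
   M/e; there [annulus rho (e / 4)] is 1. *)
have p2 : 0 <= \sum_i x ord0 i * 'D_(dir R i) (bumpr e) x
    + 2 * N%:R * M * annulus rho (e / 4) x ^+ n.+1.
  have rhs0 : 0 <= 2 * N%:R * M * annulus rho (e / 4) x ^+ n.+1.
    by apply: mulr_ge0 => //; apply: mulr_ge0 => //; exact: mulr_ge0.
  have [xin|xout] := pselect (forall j, `|x ord0 j| < e).
    rewrite big1 ?add0r// => i _.
    by rewrite (derive_bumpr_in i e0 xin) mulr0.
  have [x2|x2] := pselect (box (2 * e) x); last first.
    rewrite big1 ?add0r// => i _.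
    by rewrite (derive_bumpr_out i e0 x2) mulr0.
  have -> : annulus rho (e / 4) x = 1.
    rewrite /annulus (bumpr_in (x := x) r0); last by apply: box_le x2; lra.
    have e4 : 0 < e / 4 by rewrite divr_gt0.
    have [_ H4] := stest_bumpr N e4.
    rewrite H4 ?subr0 ?mulr1//.
    by move=> xe; apply: xout => j; apply: le_lt_trans (xe j) _; lra.
  rewrite expr1n mulr1.
  have : `|\sum_i x ord0 i * 'D_(dir R i) (bumpr e) x| <= 2 * N%:R * M.
    apply: le_trans (ler_norm_sum _ _ _) _.
    apply: (@le_trans _ _ (\sum_(i < N) (2 * M))).
      apply: ler_sum => i _; rewrite normrM.
      apply: (@le_trans _ _ (2 * e * (M / e))); first by rewrite ler_pM// derive_bumpr_le.
      by rewrite le_eqVlt; apply/orP; left; apply/eqP; field; rewrite gt_eqF.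
    by rewrite sumr_const card_ord -[leLHS]mulr_natl mulrA [_ * 2]mulrC.
  by rewrite ler_norml => /andP[? _]; lra.
rewrite div_bumpE.
have N2 : 0 <= N%:R / 2 :> R by rewrite divr_ge0.
have := ler_wpM2l N2 p1; lra.
Qed.

(** The losses from the two annuli of [div_bump_ge] divided by N/2. Size e/4 brings a factor 16 in
    [outer_mass], whence 64 = 4 * 16. *)
Definition inner_const (rho : R) : R := (2 ^+ n.+1 + 64 * M) * Kout rho.
Local Notation Kin := inner_const.

(** Removing the linear growth that the cutoff allows makes the mass nonincreasing, and its drop
    controls the gradient integral. *)
Definition corrected_mass (rho t : R) : R := mv (cut (bumpr rho)) t - C1 rho * t.
Local Notation Y := corrected_mass.

Lemma corrected_mass_nonincr rho s t : 1 <= rho -> 0 < s -> s <= t -> (t%:E < T)%E ->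
  Y rho t <= Y rho s.
Proof.
move=> r1 s0 st tT; have := bumpr_almost_decr r1 s0 st tT.
by rewrite /corrected_mass; lra.
Qed.

(** The pairing of [u] with [div_bump e] bounds the inner mass from below on the window. By the weak
    gradient it becomes a pairing of [Du] with a field of size at most 2e per coordinate. Young's
    inequality with weight [m] splits it into a gradient integral, at most twice the drop of
    [corrected_mass], and a remainder on [box (2 * e)]. *)
Lemma poincare_step rho s t e m : 1 <= rho -> 0 < s -> s < t -> (t%:E < T)%E ->
  0 < e -> 2 * e <= 1 -> 0 < m ->
  (t - s) * (Y rho t - Kin rho / e ^+ 2 * t) <=
  4 * m * (Y rho s - Y rho t) +
  (t - s) * (2 * ((2 * N%:R * e + (2 * N%:R * e) ^+ n.+1 / m ^+ n) * (4 * e) ^+ N)).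
Proof.
move=> r1 s0 st tT e0 e1 m0; have r0 : 0 < rho by apply: lt_le_trans r1.
have t0 : 0 < t := lt_trans s0 st.
have ts0 : 0 < t - s by rewrite subr_gt0.
have Ymon := corrected_mass_nonincr r1 s0 (ltW st) tT.
have [B BE] : exists B, B = (2 * N%:R * e + (2 * N%:R * e) ^+ n.+1 / m ^+ n) * (4 * e) ^+ N by eexists.
rewrite -BE.
have B0 : 0 <= B.
  by rewrite BE mulr_ge0 ?addr_ge0 ?divr_ge0 ?exprn_ge0 ?mulr_ge0 ?(ltW e0) ?(ltW m0).
(* The positive case is the one with content; the sign allows N/2 to be lowered to 1/2 at the
   end. *)
have [X0|X0] := leP (Y rho t - Kin rho / e ^+ 2 * t) 0.
  apply: (@le_trans _ _ 0); first by rewrite mulr_ge0_le0// ltW.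
  by rewrite addr_ge0// !mulr_ge0 ?subr_ge0// ltW.
move: X0; have [Xc XcE] : exists X, X = Y rho t - Kin rho / e ^+ 2 * t by eexists.
rewrite -XcE => X0.
have r20 : 0 <= 2 * rho by rewrite mulr_ge0// ltW.
have e20 : 0 <= 2 * e by rewrite mulr_ge0// ltW.
have tz := stestX n (stest_bumpr N r0); have wz := stest_weight r20 tz.
have ta := stestX n (stest_annulus e r0); have wa := stest_weight r20 ta.
have ta4 := stestX n (stest_annulus (e / 4) r0); have wa4 := stest_weight r20 ta4.
have tx i : stest (2 * e) (fun y : X => y ord0 i * bumpr e y).
  by apply: stestMl; [exact: elem_coord|exact: stest_bumpr].
have e2r : 2 * e <= 2 * rho by lra.
have td : stest (2 * rho) (div_bump e).
  by apply: (stest_le e2r); apply: stest_sum => i; exact: stest_derive.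
have wd := stest_weight r20 td.
have low x : s < x -> x <= t -> N%:R / 2 * Xc <= mv (div_bump e) x.
  move=> sx xt; have x0 : 0 < x := lt_trans s0 sx.
  have xT : (x%:E < T)%E by apply: le_lt_trans tT; rewrite lee_fin.
  have wz' := stest_weight r20 (stestZ (N%:R / 2) tz).
  have wa' := stest_weight r20 (stestZ (N%:R / 2 * 2 ^+ n.+1) ta).
  have wa4' := stest_weight r20 (stestZ (2 * N%:R * M) ta4).
  have := mass_le u_ge0 hv x0 xT wz' (weightD wd (weightD wa4' wa')) (fun y => div_bump_ge y r1 e0 e1).
  rewrite (massZ v_L1 _ x0 xT wz) (massD v_L1 x0 xT wd (weightD wa4' wa')).
  rewrite (massD v_L1 x0 xT wa4' wa') (massZ v_L1 _ x0 xT wa) (massZ v_L1 _ x0 xT wa4) => H.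
  have o1 : mv (cut (annulus rho e)) x <= Kout rho / e ^+ 2 * t.
    apply: (@le_trans _ _ (Kout rho / e ^+ 2 * x)); first by apply: outer_mass => //; lra.
    rewrite ler_wpM2l// divr_ge0 ?exprn_ge0 ?(ltW e0)//.
    by rewrite mulr_ge0 ?addr_ge0 ?exprn_ge0 ?(ltW r0)// mulr_ge0 ?exprn_ge0.
  have o4 : mv (cut (annulus rho (e / 4))) x <= 16 * (Kout rho / e ^+ 2) * t.
    apply: (@le_trans _ _ (Kout rho / (e / 4) ^+ 2 * x)); first by apply: outer_mass => //; lra.
    have -> : Kout rho / (e / 4) ^+ 2 = 16 * (Kout rho / e ^+ 2) by field; rewrite gt_eqF.
    rewrite ler_wpM2l// mulr_ge0// divr_ge0 ?exprn_ge0 ?(ltW e0)//.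
    by rewrite mulr_ge0 ?addr_ge0 ?exprn_ge0 ?(ltW r0)// mulr_ge0 ?exprn_ge0.
  have dec := bumpr_almost_decr r1 x0 xt tT.
  have N2 : 0 <= N%:R / 2 :> R by rewrite divr_ge0.
  have c1 : 0 <= N%:R / 2 * 2 ^+ n.+1 :> R by rewrite mulr_ge0 ?exprn_ge0.
  have c4 : 0 <= 2 * N%:R * M by rewrite mulr_ge0// mulr_ge0.
  have h1 := ler_wpM2l c1 o1; have h4 := ler_wpM2l c4 o4.
  have Xle : Xc <= mv (cut (bumpr rho)) x - Kin rho / e ^+ 2 * t.
    have : 0 <= C1 rho * x by rewrite mulr_ge0 ?C1_ge0// ltW.
    by rewrite XcE /corrected_mass; lra.
  have h5 := ler_wpM2l N2 Xle.
  apply: le_trans h5 _.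
  have E : N%:R / 2 * (mv (cut (bumpr rho)) x - Kin rho / e ^+ 2 * t) =
     N%:R / 2 * mv (cut (bumpr rho)) x - (N%:R / 2 * 2 ^+ n.+1 * (Kout rho / e ^+ 2 * t) +
     2 * N%:R * M * (16 * (Kout rho / e ^+ 2) * t)).
    by rewrite /inner_const; field; rewrite gt_eqF.
  by rewrite E; lra.
have st' := ltW st.
have low2 := tpairing_u_ge hu hv s0 st' tT wd low.
have ww : weight (seg s t) (win s t : measurableTypeR R -> R) by exact: win_weight.
have wN i := stest_weight e20 (stestZ (-1) (tx i)).
have wxi i := stest_weight e20 (tx i).
have wDx i := stest_weight e20 (stest_derive (dir R i) (tx i)).
have PE : tpairing T u (div_bump e) (win s t) =
    \sum_i tgrad i (fun x : X => -1 * (x ord0 i * bumpr e x)) (win s t).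
  rewrite /div_bump (tpairing_sum _ s0 tT hu ww wDx).
  apply: eq_bigr => i _.
  by rewrite (weak_grad hu hDu s0 st' tT i e20 (tx i)) (tpairingZ s0 tT (Du_locint hDu _) ww _ (wxi i)) mulN1r.
have wmz := stest_weight r20 (stestZ (- m) tz).
have sub_e : box (2 * e) `<=` (box (2 * rho) : set X) by apply: box_le.
have wN' i := weight_le sub_e (wN i).
have E4 : 2 * (2 * e) = 4 * e by ring.
have := combo_le hDu hg s0 st' tT (f_ := fun i x => -1 * (x ord0 i * bumpr e x))
   (f := fun x => - m * cut (bumpr rho) x) (r := 2 * rho)
   (C1 := 2 * N%:R * e + (2 * N%:R * e) ^+ n.+1 / m ^+ n) (r1 := 2 * e) (C2 := 0) (r2 := 0)
   wN' wmz e20 (lexx _).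
rewrite (tpairingZ s0 tT hg ww _ wz) -PE mul0r addr0 E4 -BE => H.
have {}H : tpairing T u (div_bump e) (win s t) - m * tpairing T g (cut (bumpr rho)) (win s t) <= B * (t - s).
  rewrite -mulNr; apply: H => z; rewrite mul0r addr0.
  have a0 := euclidean_norm_ge0 z.
  have [xe|xe] := pselect (box (2 * e) z.1); last first.
    rewrite big1 => [|i _]; last by have [_ ->] := tx i; rewrite ?mulr0.
    rewrite add0r indicE memNset// mulr0 mulNr mulrN oppr_le0 mulr_ge0 ?powR_ge0//.
    by rewrite mulr_ge0 ?(ltW m0)// exprn_ge0// bumpr_ge0.
  rewrite indicE mem_set// mulr1 (bumpr_in (x := z.1) r0); last by apply: box_le xe; lra.
  rewrite expr1n mulr1.
  have b0 : 0 <= 2 * N%:R * e by rewrite mulr_ge0 ?mulr_ge0// ltW.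
  (* [xi = 1] since [bumpr rho] is 1 on [box (2 * e)]. *)
  have := @young_absorb R q (euclidean_norm (Du z)) (2 * N%:R * e) m 1 n hq a0 b0 m0 _.
  rewrite !expr1n !mulr1 ler01 lexx => /(_ isT) Yg.
  have S : \sum_i Du z ord0 i * (-1 * (z.1 ord0 i * bumpr e z.1)) <=
      euclidean_norm (Du z) * (2 * N%:R * e).
    apply: (@le_trans _ _ (\sum_(i < N) euclidean_norm (Du z) * (2 * e))).
      apply: ler_sum => i _; apply: le_trans (ler_norm _) _.
      rewrite !normrM normrN1 mul1r ler_pM ?abs_coord_le ?mulr_ge0//.
      have /andP[c0 c1] := bumpr01 e z.1.
      rewrite (ger0_norm c0); apply: le_trans (xe i).
      by rewrite ler_piMr.
    rewrite sumr_const card_ord -[leLHS]mulr_natl.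
    by rewrite le_eqVlt; apply/orP; left; apply/eqP; ring.
  rewrite -/g [g z * - m]mulrN [g z * m]mulrC.
  by rewrite -/(g z) in Yg; lra.
have Ab := absorbed_bumpr s0 st' tT r1.
have Pg2 : tpairing T g (cut (bumpr rho)) (win s t) <= 2 * (Y rho s - Y rho t).
  by rewrite /corrected_mass; rewrite -/(C1 rho) in Ab; lra.
have mP := ler_wpM2l (ltW m0) Pg2.
have N1 : 1 <= N%:R :> R by rewrite ler1n.
have : 1 / 2 * Xc * (t - s) <= N%:R / 2 * Xc * (t - s).
  by rewrite ler_wpM2r ?(ltW ts0)// ler_wpM2r ?(ltW X0)//; lra.
by lra.
Qed.

(** * Vanishing of the mass as t -> 0 *)

Hypothesis hT : (0 < T)%E.

Lemma inner_const_ge0 rho : 1 <= rho -> 0 <= Kin rho.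
Proof.
move=> r1; have r0 : 0 <= rho by lra.
apply: mulr_ge0; first by rewrite addr_ge0 ?exprn_ge0// mulr_ge0.
apply: mulr_ge0; first by apply: mulr_ge0 => //; exact: exprn_ge0.
by rewrite addr_ge0// exprn_ge0.
Qed.

(** With e^2 = L t and m = K t, the remainder contains e^(n+1) e^N / m^n = e^(2n) / m^n = (L/K)^n:
    this cancellation of t is the critical balance. [eta] absorbs the annular loss and the linear
    Young term, a third each. *)
Lemma parabolic_scaling rho eta : 1 <= rho -> 0 < eta ->
  exists A t0, [/\ 0 <= A, 0 < t0, (t0%:E < T)%E &
    forall s t K, 0 < s -> s < t -> t <= t0 -> 0 < K ->
      (t - s) * (Y rho t - eta) <=
      4 * K * t * (Y rho s - Y rho t) + (t - s) * (A / K ^+ n)].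
Proof.
move=> r1 eta0; have Kin0 := inner_const_ge0 r1.
have [t1] := time_margin hT; rewrite add0r => t10 t1T.
(* The annular loss is [Kin rho / L], at most [eta / 3]. *)
have [L LE] : exists L, L = 3 * Kin rho / eta + 1 by eexists.
have L1 : 1 <= L.
  by rewrite LE lerDr; apply: divr_ge0; [exact: mulr_ge0|exact: ltW].
have L0 : 0 < L by apply: lt_le_trans L1.
have N1 : 1 <= N%:R :> R by rewrite ler1n.
(* An upper bound for [e]: the summand [12 * N] puts the linear Young term below [eta / 3], and
   [4 * eta] ensures 4 e <= 1. *)
have [d dE] : exists d, d = eta / (12 * N%:R + 4 * eta) by eexists.
have den0 : 0 < 12 * N%:R + 4 * eta by lra.
have d0 : 0 < d by rewrite dE divr_gt0.
have d4 : 4 * d <= 1.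
  by rewrite dE mulrA ler_pdivrMr// mul1r; lra.
have dN : 12 * N%:R * d <= eta.
  rewrite dE mulrA ler_pdivrMr// mulrC ler_wpM2l ?(ltW eta0)//; lra.
pose A := 2 * (2 * N%:R) ^+ n.+1 * 4 ^+ N * L ^+ n.
exists A, (Num.min t1 (d ^+ 2 / L)); split.
- by apply: mulr_ge0; rewrite ?exprn_ge0 ?(ltW L0)//; apply: mulr_ge0;
    rewrite ?exprn_ge0//; apply: mulr_ge0 => //; rewrite exprn_ge0// mulr_ge0.
- by rewrite lt_min t10 divr_gt0 ?exprn_gt0.
- by apply: le_lt_trans t1T; rewrite lee_fin ge_min lexx.
move=> s t K s0 st; rewrite le_min => /andP[tt1 td] K0.
have t0 : 0 < t := lt_trans s0 st.
have ts0 : 0 < t - s by rewrite subr_gt0.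
have tT : (t%:E < T)%E by apply: le_lt_trans t1T; rewrite lee_fin.
have Lt0 : 0 < L * t by rewrite mulr_gt0.
have [e eE] : exists e, e = Num.sqrt (L * t) by eexists.
have e0 : 0 < e by rewrite eE sqrtr_gt0.
have e2 : e ^+ 2 = L * t by rewrite eE sqr_sqrtr// ltW.
have ed : e <= d.
  rewrite -(@ler_pXn2r R 2)// ?nnegrE ?(ltW e0) ?(ltW d0)// e2.
  by rewrite mulrC -ler_pdivlMr.
have e1 : 2 * e <= 1 by lra.
have Kt0 : 0 < K * t by rewrite mulr_gt0.
have H := poincare_step r1 s0 st tT e0 e1 Kt0.
have B1 : Kin rho / e ^+ 2 * t <= eta / 3.
  rewrite e2 (_ : Kin rho / (L * t) * t = Kin rho / L); last first.
    by field; rewrite !gt_eqF.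
  rewrite ler_pdivrMr// LE mulrDr mulr1.
  have -> : eta / 3 * (3 * Kin rho / eta) = Kin rho by field; rewrite gt_eqF.
  by rewrite lerDl divr_ge0// ltW.
have B2 : 2 * ((2 * N%:R * e + (2 * N%:R * e) ^+ n.+1 / (K * t) ^+ n) * (4 * e) ^+ N)
    <= eta / 3 + A / K ^+ n.
  have dist (a b c : R) : 2 * ((a + b) * c) = 2 * (a * c) + 2 * (b * c) by ring.
  rewrite dist; apply: lerD.
    have p1 : (4 * e) ^+ N <= 1 by apply: exprn_ile1; lra.
    have p2 : 2 * N%:R * e * (4 * e) ^+ N <= 2 * N%:R * e.
      by rewrite ler_piMr// mulr_ge0 ?mulr_ge0// ltW.
    have p3 : 12 * N%:R * e <= eta.
      by apply: le_trans dN; rewrite ler_wpM2l// mulr_ge0.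
    by lra.
  have E : e ^+ n.+1 * e ^+ N = L ^+ n * t ^+ n.
    by rewrite -exprD -exprMn -e2 -exprM; congr (_ ^+ _); rewrite addSn mulSn mulSn mul0n addn0 -addnS.
  have tn0 : t ^+ n != 0 by rewrite expf_neq0// gt_eqF.
  have Kn0 : K ^+ n != 0 by rewrite expf_neq0// gt_eqF.
  rewrite le_eqVlt; apply/orP; left; apply/eqP; rewrite [in LHS]exprMn [(4 * e) ^+ N]exprMn [(K * t) ^+ n]exprMn /A.
  transitivity (2 * (2 * N%:R) ^+ n.+1 * 4 ^+ N * (e ^+ n.+1 * e ^+ N) / (K ^+ n * t ^+ n)).
    by ring.
  by rewrite E; field; rewrite tn0 Kn0.
have H2 := ler_wpM2l (ltW ts0) B2.
have H3 := ler_wpM2l (ltW ts0) B1.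
rewrite mulrA in H.
have -> : (t - s) * (Y rho t - eta) = (t - s) * (Y rho t - Kin rho / e ^+ 2 * t) +
   (t - s) * (Kin rho / e ^+ 2 * t) - (t - s) * eta by ring.
have ee : 0 <= (t - s) * eta by rewrite mulr_ge0// ltW.
by lra.
Qed.

(** The threshold [e / 4] in [backward_blowup] gives [Y <= e / 2]; the linear correction fits into
    the other half for small times. *)
Lemma mass_vanishes rho : 1 <= rho -> mv (cut (bumpr rho)) s @[s --> 0^'+] --> 0.
Proof.
move=> r1; have r0 : 0 < rho by lra.
have r20 : 0 <= 2 * rho by rewrite mulr_ge0// ltW.
have wz := stest_weight r20 (stestX n (stest_bumpr N r0)).
apply/cvgrPdist_le => e e0.
have e4 : 0 < e / 4 by rewrite divr_gt0.
have [A [t0 [A0 t00 t0T H]]] := parabolic_scaling r1 e4.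
have Ydec s t : 0 < s -> s <= t -> t <= t0 -> Y rho t <= Y rho s.
  by move=> s0 st tt; apply: corrected_mass_nonincr => //; apply: le_lt_trans t0T; rewrite lee_fin.
have Yle := @backward_blowup R (Y rho) n t0 (e / 4) A isT e4 A0 Ydec H.
have C10 := C1_ge0 r1.
near=> s.
have s0 : 0 < s by near: s; exact: nbhs_right_gt.
have st : s <= t0 by near: s; exact: nbhs_right_le.
have sT : (s%:E < T)%E by apply: le_lt_trans t0T; rewrite lee_fin.
have sC : s <= e / (2 * (C1 rho + 1)).
  near: s; apply: nbhs_right_le; rewrite divr_gt0// mulr_gt0//; lra.
have F0 : 0 <= mv (cut (bumpr rho)) s.
  by apply: (mass_ge0 u_ge0 hv s0 sT wz) => x; rewrite exprn_ge0// bumpr_ge0.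
rewrite sub0r normrN ger0_norm//.
have := Yle s s0 st; rewrite /corrected_mass => Yl.
have : C1 rho * s <= e / 2.
  apply: (@le_trans _ _ ((C1 rho + 1) * (e / (2 * (C1 rho + 1))))).
    by rewrite ler_pM// ?(ltW s0)// lerDl.
  by rewrite le_eqVlt; apply/orP; left; apply/eqP; field; rewrite gt_eqF//; lra.
by lra.
Unshelve. all: by end_near.
Qed.

Lemma mass_linear rho t : 1 <= rho -> 0 < t -> (t%:E < T)%E ->
  mv (cut (bumpr rho)) t <= C1 rho * t.
Proof.
move=> r1 t0 tT; apply: (limit_bound (mass_vanishes r1) t0 (C1_ge0 r1)) => s s0 st.
exact: bumpr_almost_decr.
Qed.

(** * Decay in the radius and conclusion *)

Variable L : R.
Hypothesis L0 : 0 <= L.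
Hypothesis lap_bumpr_le : forall (r : R) (x : X), 0 < r ->
  lap (cut (bumpr r)) x <= L / r ^+ 2 * bumpr (2 * r) x ^+ n.+1.

(** Dropping the absorption term makes [u] a subsolution of the heat equation, with zero initial
    mass by [mass_vanishes]. *)
Lemma mass_double rho t V : 1 <= rho -> 0 < t -> (t%:E < T)%E -> 0 <= V ->
  (forall s, 0 < s -> s <= t -> mv (cut (bumpr (2 * rho))) s <= V) ->
  mv (cut (bumpr rho)) t <= L / rho ^+ 2 * V * t.
Proof.
move=> r1 t0 tT V0 HV; have r0 : 0 < rho by lra.
have r20 : 0 <= 2 * rho by rewrite mulr_ge0// ltW.
have tr0 : 0 < 2 * rho by rewrite mulr_gt0.
have r40 : 0 <= 2 * (2 * rho) by rewrite mulr_ge0.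
have r24 : 2 * rho <= 2 * (2 * rho) by lra.
have tz := stestX n (stest_bumpr N r0).
have wz2 := stest_weight r40 (stestX n (stest_bumpr N tr0)).
have wl := stest_weight r40 (stest_le r24 (stest_lap tz)).
have wL := stest_weight r40 (stestZ (L / rho ^+ 2) (stestX n (stest_bumpr N tr0))).
have Lr0 : 0 <= L / rho ^+ 2 by rewrite divr_ge0// exprn_ge0// ltW.
apply: (limit_bound (mass_vanishes r1) t0); first exact: mulr_ge0.
move=> s s0 st; rewrite -lerBlDl (energy hu hg hHJ hv s0 st tT r20 tz).
have g0 : 0 <= tpairing T g (cut (bumpr rho)) (win s t).
  by apply: tpairing_g_ge0 => x; rewrite exprn_ge0// bumpr_ge0.
suff : tpairing T u (lap (cut (bumpr rho))) (win s t) <= L / rho ^+ 2 * V * (t - s).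
  by rewrite -/g; lra.
apply: (tpairing_u_le hu hv s0 st tT wl) => x sx xt.
have x0 : 0 < x := lt_trans s0 sx.
have xT : (x%:E < T)%E by apply: le_lt_trans tT; rewrite lee_fin.
apply: (le_trans (mass_le u_ge0 hv x0 xT wl wL (fun y => lap_bumpr_le y r0))).
rewrite (massZ v_L1 _ x0 xT wz2) ler_wpM2l//; exact: HV.
Qed.

(** Each use of [mass_double] gains rho^-2, at the price of 2^N for the doubled radius. The power is
    a quotient because N - 2k becomes negative. *)
Lemma mass_decay t0 k : 0 < t0 -> (t0%:E < T)%E -> exists2 K : R, 0 <= K &
  forall rho t, 1 <= rho -> 0 < t -> t <= t0 ->
    mv (cut (bumpr rho)) t <= K * (rho ^+ N / rho ^+ (2 * k)).
Proof.
move=> t00 t0T; elim: k => [|k [K K0 IH]].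
  exists (C * 4 ^+ N * t0); first by rewrite mulr_ge0 ?(ltW t00)// mulr_ge0// exprn_ge0.
  move=> rho t r1 tp tt; rewrite muln0 expr0 divr1.
  have tT : (t%:E < T)%E by apply: le_lt_trans t0T; rewrite lee_fin.
  apply: (le_trans (mass_linear r1 tp tT)); rewrite /slope_const exprMn mulrA.
  have c0 : 0 <= C * 4 ^+ N * rho ^+ N.
    apply: mulr_ge0; first by apply: mulr_ge0 => //; exact: exprn_ge0.
    by apply: exprn_ge0; lra.
  by have := ler_wpM2l c0 tt; lra.
exists (L * (K * 2 ^+ N) * t0).
  by apply: mulr_ge0; [apply: mulr_ge0 => //; apply: mulr_ge0 => //; exact: exprn_ge0|exact: ltW].
move=> rho t r1 tp tt; have r0 : 0 < rho by lra.
have tT : (t%:E < T)%E by apply: le_lt_trans t0T; rewrite lee_fin.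
have rr1 : 1 <= 2 * rho by lra.
have q0 : 0 <= rho ^+ N / rho ^+ (2 * k) by rewrite divr_ge0// exprn_ge0// ltW.
have V0 : 0 <= K * 2 ^+ N * (rho ^+ N / rho ^+ (2 * k)).
  by apply: mulr_ge0 => //; apply: mulr_ge0 => //; exact: exprn_ge0.
have HV s : 0 < s -> s <= t ->
    mv (cut (bumpr (2 * rho))) s <= K * 2 ^+ N * (rho ^+ N / rho ^+ (2 * k)).
  move=> s0 st; apply: (le_trans (IH (2 * rho) s rr1 s0 (le_trans st tt))).
  rewrite -mulrA ler_wpM2l// mulrA [(2 * rho) ^+ N]exprMn.
  rewrite ler_wpM2l//; first by rewrite mulr_ge0 ?exprn_ge0// ltW.
  have le1 : rho ^+ (2 * k) <= (2 * rho) ^+ (2 * k).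
    by apply: lerXn2r; rewrite ?nnegrE; lra.
  by rewrite lef_pV2 ?posrE ?exprn_gt0//; lra.
apply: (le_trans (mass_double r1 tp tT V0 HV)).
have rk : rho ^+ (2 * k) != 0 by rewrite expf_neq0// gt_eqF.
have r2 : rho ^+ 2 != 0 by rewrite expf_neq0// gt_eqF.
have -> : L * (K * 2 ^+ N) * t0 * (rho ^+ N / rho ^+ (2 * k.+1)) =
    L / rho ^+ 2 * (K * 2 ^+ N * (rho ^+ N / rho ^+ (2 * k))) * t0.
  rewrite mulnS exprD; move: (rho ^+ 2) (rho ^+ (2 * k)) (rho ^+ N) (2 ^+ N) r2 rk => a b c d a0 b0.
  by field; rewrite a0 b0.
apply: ler_wpM2l => //; apply: mulr_ge0 => //.
by rewrite divr_ge0// exprn_ge0// ltW.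
Qed.

Lemma bumpr_le_bumpr r s (x : X) : 0 < r -> 2 * r <= s -> bumpr r x <= bumpr s x.
Proof.
move=> r0 rs; have s0 : 0 < s by lra.
have [xr|xr] := pselect (box (2 * r) x).
  by rewrite (bumpr_in (x := x) s0) ?bumpr_le1//; exact: box_le xr.
by have [_ ->] := stest_bumpr N r0; rewrite ?bumpr_ge0.
Qed.

Lemma mass_eq0 rho t : 1 <= rho -> 0 < t -> (t%:E < T)%E -> mv (cut (bumpr rho)) t = 0.
Proof.
move=> r1 t0 tT; have r0 : 0 < rho by lra.
have r20 : 0 <= 2 * rho by rewrite mulr_ge0// ltW.
have wz := stest_weight r20 (stestX n (stest_bumpr N r0)).
apply/le_anti/andP; split; last first.
  by apply: (mass_ge0 u_ge0 hv t0 tT wz) => x; rewrite exprn_ge0// bumpr_ge0.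
(* k = N+1 leaves r^(-N-2), which is below 1/r for r >= 1. *)
have [K K0 HK] := mass_decay N.+1 t0 tT.
apply/ler_addgt0Pr => e e0; rewrite add0r.
(* The first summand makes the larger cutoff dominate [bumpr rho], the second gives K / r' <= e. *)
pose r' := 2 * rho + K / e.
have Ke : 0 <= K / e by rewrite divr_ge0// ltW.
have r'1 : 1 <= r' by rewrite /r'; lra.
have r'0 : 0 < r' by lra.
have r2r' : 2 * rho <= 2 * r' by rewrite /r'; lra.
have wz' := weight_le (box_le r2r') wz.
have r'20 : 0 <= 2 * r' by rewrite mulr_ge0// ltW.
have wz'' := stest_weight r'20 (stestX n (stest_bumpr N r'0)).
have le1 : mv (cut (bumpr rho)) t <= mv (cut (bumpr r')) t.
  apply: (mass_le u_ge0 hv t0 tT wz' wz'') => x.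
  rewrite lerXn2r ?nnegrE ?bumpr_ge0// bumpr_le_bumpr// /r'; lra.
apply: (le_trans le1); apply: (le_trans (HK r' t r'1 t0 (lexx t))).
have le2 : r' ^+ N / r' ^+ (2 * N.+1) <= r'^-1.
  rewrite ler_pdivrMr ?exprn_gt0// ler_pdivlMl//.
  rewrite -exprS; apply: ler_weXn2l => //.
  by rewrite mul2n -addnn leq_addr.
apply: (le_trans (ler_wpM2l K0 le2)).
rewrite ler_pdivrMr// -ler_pdivrMl// mulrC /r'; lra.
Qed.

Lemma solution_vanishes t : 0 < t -> (t%:E < T)%E -> {ae mux, forall x, v t x = 0}.
Proof.
pose zeta (k : nat) (x : X) : R := bumpr k.+1%:R x ^+ n.+1.
have k1 k : 1 <= k.+1%:R :> R by rewrite ler1n.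
have k0 k : 0 < k.+1%:R :> R by rewrite ltr0n.
have k20 k : 0 <= 2 * k.+1%:R :> R by rewrite mulr_ge0.
apply: (v_ae_eq0 u_ge0 hv (zeta := zeta) (r := fun k => 2 * k.+1%:R)).
- by move=> k; apply: stest_weight => //; apply: stestX; exact: stest_bumpr.
- by move=> k x; rewrite exprn_ge0// bumpr_ge0.
- by move=> k x xk; rewrite /zeta (bumpr_in (x := x) (k0 k) xk) expr1n.
- by move=> k s s0 sT; exact: mass_eq0.
Qed.

End core.

Lemma Lp_loc_locint_powR (R : realType) (N : nat) (T : \bar R) (q : R)
    (f : 'rV[R]_N * R -> R) : (forall z, 0 <= f z) ->
  Lp_loc_cylinder T q f -> locint T (fun z => f z `^ q).
Proof.
move=> f0 [mf fq]; apply: Lp_loc_locint; split.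
  exact: (measurableT_comp (measurable_powR q) mf).
move=> K KT; have := fq K KT.
under eq_integral do rewrite ger0_norm//.
by under [in X in _ -> X]eq_integral do rewrite powRr1 ?normr_ge0// ger0_norm ?powR_ge0//.
Qed.

Theorem theorem1p2 (R : realType) (N : nat) (q : R) (T : \bar R)
    (u : 'rV[R]_N * R -> R) (Du : 'rV[R]_N * R -> 'rV[R]_N)
    (v : R -> 'rV[R]_N -> R)
    (hN : (1 <= N)%N)
    (hq : (N + 2)%:R / (N + 1)%:R <= q)
    (hT : (0 < T)%E)
    (hu : Lp_loc_cylinder T 1 u)
    (u_ge0 : {ae lebesgue_spacetime R N, forall z, cylinder T z -> 0 <= u z})
    (hDu : is_weak_gradient T u Du)
    (hDuq : Lp_loc_cylinder T q (fun z => euclidean_norm (Du z)))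
    (hHJ : viscous_HJ T q u Du)
    (hv : continuous_representative T u v)
    (hlim : forall phi : 'rV[R]_N -> R, Cc (~` [set (0 : 'rV[R]_N)]) phi ->
      (\int[lebesgue_rV R N]_(x in [set: 'rV[R]_N]) (v t x * phi x))
        @[t --> 0^'+] --> 0) :
  forall t : R, 0 < t -> (t%:E < T)%E ->
    {ae lebesgue_rV R N, forall x, v t x = 0}.
Proof.
have hg : locint T (fun z => euclidean_norm (Du z) `^ q).
  by apply: Lp_loc_locint_powR hDuq => z; exact: sqrtr_ge0.
(* The lower bound on q in the form used by [young_absorb] with exponent N+1. *)
have hqn : 1 <= (q - 1) * N.+1%:R.
  move: hq; rewrite addn1 addn2 ler_pdivrMr ?ltr0n// -[N.+2]addn1 natrD => hq'.
  by lra.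
have [M M0 hM] := derive_bumpr_bound R N.
have [L L0 hL] := lap_bumpr_bound R N N.+1.
exact: (solution_vanishes hN hqn (Lp_loc_locint hu) u_ge0 hDu hg hHJ hv hlim
  M0 hM erefl erefl hT L0 hL).
Qed.
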